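(* Let $G/H$ be a quasi-affine spherical homogeneous space. Let $\gamma$ be a formal Laurent curve in $G/H$ (a $\mathbb{C}((t))$-point of $G/H$) which is convergent for sufficiently small $t\neq0$, and let $v_\gamma$ be the $G$-invariant valuation on $\mathbb{C}(G/H)$ associated to $\gamma$. Let $\lambda\in\Lambda^+_{G/H}$ and let $\phi_\lambda:G/H\to\mathbb{R}_{>0}$ be the corresponding spherical function. Then for any highest weight vector $f_\lambda\in V_\lambda\subset\mathbb{C}[G/H]$, $$\lim_{t\to0}\log_t\big(\phi_\lambda(\gamma(t))\big)=2\,v_\gamma(f_\lambda),$$ where $t\to 0$ through positive real numbers.
   Context: $G$ is a connected reductive algebraic group over $\mathbb{C}$, $B\subset G$ a Borel subgroup, $K$ a maximal compact subgroup of $G$. A homogeneous space $G/H$ ($H$ a closed algebraic subgroup) is spherical if $B$ has a dense orbit in it; $G/H$ is assumed to be a quasi-affine variety. $G$ acts on $\mathbb{C}[G/H]$ and on the field of rational functions $\mathbb{C}(G/H)$ by $(g\cdot f)(x)=f(g^{-1}x)$, and $\mathbb{C}[G/H]=\bigoplus_{\lambda\in\Lambda^+_{G/H}}V_\lambda$ is multiplicity-free, where $V_\lambda$ is the irreducible $G$-module of highest weight $\lambda$ (with respect to $B$) and $\Lambda^+_{G/H}$ is the set of highest weights that occur. A highest weight vector is a nonzero $B$-eigenvector in $V_\lambda$. Spherical functions: for $\lambda\in\Lambda^+_{G/H}$ choose a $K$-invariant Hermitian product on $V_\lambda\subset\mathbb{C}[G/H]$ and an orthonormal basis $\{f_{\lambda,i}\}_i$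 of $V_\lambda$; $\phi_\lambda:G/H\to\mathbb{R}_{>0}$ is the function $x\mapsto\sum_i|f_{\lambda,i}(x)|^2$ rescaled by a positive constant so that $\phi_\lambda(eH)=1$. A formal Laurent curve: embedding $G/H$ in an affine space, $\gamma$ is a tuple of formal Laurent series (finitely many negative exponents) giving a $\mathbb{C}((t))$-point of $G/H$; convergent for small $t\ne0$ means that these series converge in a punctured neighbourhood of $t=0$, so that $\gamma(t)\in G/H$ for such $t$. Associated valuations: $\hat v_\gamma(f)=\mathrm{ord}_t\, f(\gamma(t))$ (the order in $t$ of the Laurent series, $\infty$ for the zero series). For every $0\neq f\in\mathbb{C}(G/H)$ the value $\hat v_\gamma(g\cdot f)$ is the same for all $g$ in some nonempty Zariski-open subset $U_f\subset G$; this common value is $v_\gamma(f)$. For $0\ne f\in\mathbb{C}[G/H]$ it equals $\min_{g\in G}\hat v_\gamma(g\cdot f)$. The function $v_\gamma$ is a $G$-invariant valuation. $\log_t(y)=\ln y/\ln t$ for real $0<t<1$. *)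

(* Defs.v *)
(* The complex numbers are [R[i]] for [R : realType]. *)
From HB Require Import structures.
From mathcomp Require Import all_boot all_order all_algebra.
From mathcomp Require Import complex.
From mathcomp Require Import all_classical all_reals all_analysis.
(* The notations of mpoly clash with those of MathComp-Analysis. *)
From mathcomp Require Import -(notations) mpoly.
Set Implicit Arguments.
Unset Strict Implicit.
Unset Printing Implicit Defensive.
Import Order.TTheory GRing.Theory Num.Theory.
Import numFieldNormedType.Exports.
Local Open Scope classical_set_scope.
Local Open Scope ring_scope.

(* The Euclidean topology on the complex numbers. *)
HB.instance Definition _ (R : realType) := NormedModule.copy R[i] R[i]^o.

(* Affine space is a space of matrices, with polynomial coordinates the matrix
   entries listed by [mxvec]; this covers both GL_n inside 'M_n and subvarieties
   of 'rV_m. *)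
Section Zariski.
Variable R : realType.
Local Notation C := R[i].
Variables a b : nat.
Implicit Types Y U : set 'M[C]_(a, b).

Definition peval (p : mpoly (a * b) C) (x : 'M[C]_(a, b)) : C :=
  meval (fun i => mxvec x 0 i) p.

Definition zlocus (S : set (mpoly (a * b) C)) : set 'M[C]_(a, b) :=
  [set x | forall p, S p -> peval p x = 0].

Definition zclosure Y : set 'M[C]_(a, b) :=
  zlocus [set p | forall y, Y y -> peval p y = 0].

Definition zopen_in Y U := exists S, U = Y `\` zlocus S.

Definition locally_closed Y := zopen_in (zclosure Y) Y.

Definition zconnected Y :=
  Y !=set0 /\
  forall U V, zopen_in Y U -> zopen_in Y V ->
    Y `<=` U `|` V -> U `&` V = set0 -> U = set0 \/ V = set0.

Definition regular_on Y (f : 'M[C]_(a, b) -> C) :=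
  forall x, Y x -> exists p q, peval q x <> 0 /\
    forall y, Y y -> peval q y <> 0 -> f y = peval p y / peval q y.

End Zariski.

Section Groups.
Variable R : realType.
Local Notation C := R[i].
Variable n : nat.
Implicit Types A G H K U B : set 'M[C]_n.

Definition subgroup_GL A :=
  [/\ forall g, A g -> g \in unitmx,
      A 1%:M,
      forall g h, A g -> A h -> A (g *m h)
    & forall g, A g -> A (invmx g)].

Definition algebraic_group A :=
  subgroup_GL A /\ exists S, A = [set g | g \in unitmx] `&` zlocus S.

Definition unipotent A :=
  forall g, A g -> exists k, (g - 1%:M) ^+ k = 0.

Definition reductive G :=
  forall U, algebraic_group U -> U `<=` G ->
    (forall g u, G g -> U u -> U (g *m u *m invmx g)) ->
    zconnected U -> unipotent U -> U = [set 1%:M].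

Definition derived A : set 'M[C]_n :=
  [set x | forall D, subgroup_GL D ->
     (forall g h, A g -> A h -> D (g *m h *m invmx g *m invmx h)) -> D x].

Definition solvable_group A := exists k, iter k derived A = [set 1%:M].

Definition closed_connected_solvable_in G B :=
  [/\ algebraic_group B, B `<=` G, zconnected B & solvable_group B].

Definition borel G B :=
  closed_connected_solvable_in G B /\
  forall B', closed_connected_solvable_in G B' -> B `<=` B' -> B' = B.

Definition compact_subgroup G K :=
  [/\ subgroup_GL K, K `<=` G & compact K].

Definition maximal_compact G K :=
  compact_subgroup G K /\
  forall K', compact_subgroup G K' -> K `<=` K' -> K' = K.

Definition group_character B (lam : 'M[C]_n -> C) :=
  [/\ regular_on B lam,
      lam 1%:M = 1
    & forall g h, B g -> B h -> lam (g *m h) = lam g * lam h].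

End Groups.

(* [pi : G -> X] is the quotient of the algebraic group G by its closed subgroup
   H, as a variety, realized as a locally closed subset X of affine space. *)
Section Quotient.
Variable R : realType.
Local Notation C := R[i].
Variables n m : nat.

Record quasi_affine_quotient (G H : set 'M[C]_n) (X : set 'rV[C]_m)
    (pi : 'M[C]_n -> 'rV[C]_m) : Prop := {
  qaq_locally_closed : locally_closed X;
  qaq_morphism : forall j, regular_on G (fun g => pi g 0 j);
  qaq_surjective : pi @` G = X;
  qaq_fibres : forall g h, G g -> G h -> (pi g = pi h <-> H (invmx g *m h));
  qaq_open : forall U, zopen_in G U -> zopen_in X (pi @` U);
  qaq_functions : forall U (f : 'rV[C]_m -> C), zopen_in X U ->
    (regular_on U f <-> regular_on (G `&` pi @^-1` U) (f \o pi))
}.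

End Quotient.

(* A function on X = G/H is represented by its extension by zero to 'rV_m, so
   that equality of functions on X is Leibniz equality. *)
Section HomogeneousSpace.
Variable R : realType.
Local Notation C := R[i].
Variables n m : nat.
Variables (G : set 'M[C]_n) (X : set 'rV[C]_m) (pi : 'M[C]_n -> 'rV[C]_m).
Local Notation fctn := ('rV[C]_m -> C).
Implicit Types (f : fctn) (V W : set fctn) (B K : set 'M[C]_n).

(* g . (h H) = (g h) H *)
Definition act (g : 'M[C]_n) (x : 'rV[C]_m) : 'rV[C]_m :=
  pi (g *m xget 1%:M [set h | G h /\ pi h = x]).

Definition spherical B :=
  exists x, X x /\ X `<=` zclosure [set act b x | b in B].

Definition regular_functions : set fctn :=
  [set f | regular_on X f /\ forall x, ~ X x -> f x = 0].

Definition translate (g : 'M[C]_n) f : fctn :=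
  fun x => if x \in X then f (act (invmx g) x) else 0.

Definition submodule V :=
  [/\ V (fun=> 0),
      forall (c : C) f g, V f -> V g -> V (fun x => c * f x + g x)
    & forall g f, G g -> V f -> V (translate g f)].

Definition irreducible V :=
  [/\ submodule V,
      V <> [set (fun=> 0)]
    & forall W, submodule W -> W `<=` V -> W = [set (fun=> 0)] \/ W = V].

Definition eigenvector B (chi : 'M[C]_n -> C) f :=
  f <> (fun=> 0) /\
  forall g, B g -> translate g f = (fun x => chi g * f x).

(* V is the irreducible constituent V_lam of C[G/H]. *)
Definition is_V_lambda B (lam : 'M[C]_n -> C) V :=
  [/\ group_character B lam,
      V `<=` regular_functions,
      irreducible V
    & exists f, V f /\ eigenvector B lam f].

Definition Lambda_plus B : set ('M[C]_n -> C) :=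
  [set lam | exists V, is_V_lambda B lam V].

Definition highest_weight_vector B V f :=
  V f /\ exists chi, eigenvector B chi f.

Definition hermitian_product V (ip : fctn -> fctn -> C) :=
  [/\ forall (c : C) f g h, V f -> V g -> V h ->
        ip (fun x => c * f x + g x) h = c * ip f h + ip g h,
      forall f g, V f -> V g -> ip g f = (ip f g)^*
    & forall f, V f -> f <> (fun=> 0) -> 0 < ip f f].

Definition invariant_product K V (ip : fctn -> fctn -> C) :=
  forall k f g, K k -> V f -> V g ->
    ip (translate k f) (translate k g) = ip f g.

Definition orthonormal_basis V (ip : fctn -> fctn -> C) d (e : 'I_d -> fctn) :=
  [/\ forall i, V (e i),
      forall i j, ip (e i) (e j) = (i == j)%:R
    & forall f, V f -> exists c : 'I_d -> C,
        f = (fun x => \sum_(i < d) c i * e i x)].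

(* The base point eH is [pi 1%:M]. *)
Definition spherical_function K V (phi : 'rV[C]_m -> R) :=
  exists (ip : fctn -> fctn -> C) (d : nat) (e : 'I_d -> fctn) (c : R),
    [/\ hermitian_product V ip,
        invariant_product K V ip,
        orthonormal_basis V ip e,
        0 < c
      & (forall x, X x -> (phi x)%:C%C = c%:C%C * \sum_(i < d) `|e i x| ^+ 2) /\
        phi (pi 1%:M) = 1].

End HomogeneousSpace.

(* A formal Laurent series sum_k L_k t^k is its coefficient function
   [L : int -> C], subject to the predicate [laurent]. *)
Section Laurent.
Variable R : realType.
Local Notation C := R[i].
Implicit Types L M : int -> C.

Definition laurent L := exists N : int, forall k, k < N -> L k = 0.

Definition lone : int -> C := fun k => (k == 0)%:R.

(* The sum has finite support when both factors are [laurent]. *)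
Definition lmul L M : int -> C :=
  fun k => \sum_(i \in [set: int]) L i * M (k - i).

Definition leval a b (p : mpoly (a * b) C) (gam : 'M[int -> C]_(a, b)) :
    int -> C :=
  fun k => \sum_(mu <- msupp p) mcoeff mu p *
    (\big[lmul/lone]_(i < a * b) iter (mu i) (lmul (mxvec gam 0 i)) lone) k.

Definition lord L : \bar int :=
  xget +oo%E
    [set k%:E%E | k in [set k : int | L k <> 0 /\ forall j, j < k -> L j = 0]].

Definition lpartial L (z : C) : nat -> C :=
  fun N => \sum_(i < (2 * N).+1) L (i%:Z - N%:Z) * z ^ (i%:Z - N%:Z).

Definition lconverges L (z : C) := cvgn (lpartial L z).

Definition lsum L (z : C) : C := limn (lpartial L z).

End Laurent.

Section Curve.
Variable R : realType.
Local Notation C := R[i].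
Variables n m : nat.
Variables (G : set 'M[C]_n) (X : set 'rV[C]_m) (pi : 'M[C]_n -> 'rV[C]_m).
Variable gam : 'rV[int -> C]_m.

(* gam is a C((t))-point of the locally closed subvariety X: it lies in the
   closure of X and outside of the closed complement of X therein. *)
Definition laurent_point :=
  [/\ forall j, laurent (gam 0 j),
      forall p, (forall x, X x -> peval p x = 0) -> leval p gam = (fun=> 0)
    & exists q, (forall x, (zclosure X `\` X) x -> peval q x = 0) /\
        leval q gam <> (fun=> 0)].

Definition curve_at (z : C) : 'rV[C]_m := \row_j lsum (gam 0 j) z.

Definition convergent_curve :=
  exists eps : R, 0 < eps /\ forall z : C, 0 < `|z| -> `|z| < eps%:C%C ->
    (forall j, lconverges (gam 0 j) z) /\ X (curve_at z).

(* f(gam(t)), for a rational function f on X (given by any function that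
   represents it on a nonempty open subset of the irreducible variety X) that
   equals p / q with q(gam) != 0. *)
Definition curve_pullback (f : 'rV[C]_m -> C) : int -> C :=
  xget (fun=> 0) [set L | laurent L /\ exists p q U,
    [/\ zopen_in X U,
        U !=set0,
        forall x, U x -> f x * peval q x = peval p x,
        leval q gam <> (fun=> 0)
      & lmul (leval q gam) L = leval p gam]].

Definition vhat (f : 'rV[C]_m -> C) : \bar int := lord (curve_pullback f).

(* The generic value of [vhat (g . f)]; it always exists. *)
Definition valuation (f : 'rV[C]_m -> C) : \bar int :=
  xget +oo%E [set v | exists U, [/\ zopen_in G U, U !=set0 &
    forall g, U g -> vhat (translate G X pi g f) = v]].

End Curve.

Definition log_base (R : realType) (t y : R) : R := ln y / ln t.

(* Main.v *)
(* By irreducibility of X = G/H, the order of the pullback of a regular function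
   h along gamma is the exponent of the leading term of h(gamma(t)) as t -> 0.
   Let k be the least of these orders over an orthonormal basis e_i of V_lambda,
   and let l be the linear form on V_lambda giving the coefficient of t^k.  Then
   phi_lambda(gamma(t)) = c * sum_i |e_i(gamma(t))|^2 is asymptotic to
   c * (sum_i |l(e_i)|^2) * t^(2k), and this constant is positive, so log_t of it
   tends to 2k.  On the other hand l is a combination of evaluations at points of
   X, so {g | l(g.f) <> 0} is Zariski open in G; it is nonempty because V_lambda
   is irreducible and l <> 0.  On this set the order of g.f is k, so v_gamma(f) = k
   since nonempty open subsets of the connected group G meet. *)

Require Import Defs.
From HB Require Import structures.
From mathcomp Require Import all_boot all_order all_algebra.
From mathcomp Require Import complex.
From mathcomp Require Import all_classical all_reals all_analysis.
From mathcomp Require Import -(notations) mpoly.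
From mathcomp Require Import ring zify.
Set Implicit Arguments.
Unset Strict Implicit.
Unset Printing Implicit Defensive.
Import Order.TTheory GRing.Theory Num.Theory.
Import numFieldNormedType.Exports.
Local Open Scope classical_set_scope.
Local Open Scope ring_scope.

(** * Zariski topology and regular functions *)

(** Irreducibility must be extracted from the connectedness of a group of matrices. In place of
    irreducible components the proof measures the rank of the matrices with entries [p (h_i h'_j)],
    which is finite because matrix multiplication is bilinear. It is needed because [curve_pullback]
    selects some fraction [p / q] representing the function on some open set, which the curve may
    miss: two such fractions agree on all of X only by irreducibility. The formal and the analytic
    sides are joined by expansions with an explicit geometric remainder, so that no infinite sum is
    ever rearranged. *)

Section ZariskiTheory.
Variable R : realType.
Local Notation C := R[i].

Section OneSpace.
Variables a b : nat.
Implicit Types (Y U V : set 'M[C]_(a, b)) (f g : 'M[C]_(a, b) -> C).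

Lemma pevalM (p q : mpoly (a * b) C) (x : 'M[C]_(a, b)) :
  peval (p * q) x = peval p x * peval q x.
Proof. exact: mevalM. Qed.

Lemma pevalD (p q : mpoly (a * b) C) (x : 'M[C]_(a, b)) :
  peval (p + q) x = peval p x + peval q x.
Proof. exact: mevalD. Qed.

Lemma pevalB (p q : mpoly (a * b) C) (x : 'M[C]_(a, b)) :
  peval (p - q) x = peval p x - peval q x.
Proof. exact: mevalB. Qed.

Lemma pevalC (c : C) (x : 'M[C]_(a, b)) : peval (mpolyC (a * b) c) x = c.
Proof. exact: mevalC. Qed.

Lemma zopenP Y U : zopen_in Y U <->
  U `<=` Y /\ forall x, U x ->
    exists s, peval s x <> 0 /\ forall y, Y y -> peval s y <> 0 -> U y.
Proof.
split=> [[S ->]|[sUY hU]].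
  split=> [x []//|x [Yx]]; rewrite /zlocus /= => /existsNP[s /not_implyP[Ss sx]].
  by exists s; split=> // y Yy sy; split=> // /(_ s Ss).
(* The largest possible family: every polynomial whose nonvanishing locus in [Y] lies in [U]. *)
exists [set s | forall y, Y y -> peval s y <> 0 -> U y].
apply/seteqP; split=> [x Ux|x [Yx]].
  split; first exact: sUY.
  by have [s [sx hs]] := hU x Ux => /(_ s hs).
by move=> /existsNP[s /not_implyP[hs sx]]; exact: (hs x).
Qed.

Lemma zopenI Y U V : zopen_in Y U -> zopen_in Y V -> zopen_in Y (U `&` V).
Proof.
move=> /zopenP[sU hU] /zopenP[sV hV]; apply/zopenP; split=> [x [/sU]//|x [Ux Vx]].
have [s [sx hs]] := hU x Ux; have [s' [sx' hs']] := hV x Vx.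
exists (s * s'); split=> [|y Yy]; first by rewrite pevalM => /eqP; rewrite mulf_eq0 => /orP[]/eqP.
rewrite pevalM => ss; split; [apply: hs => // s0|apply: hs' => // s0];
  by apply: ss; rewrite s0 ?mul0r ?mulr0.
Qed.

Lemma zopenT Y : zopen_in Y Y.
Proof.
by apply/zopenP; split=> // x Yx; exists (mpolyC _ 1); split=> //; rewrite pevalC; apply/eqP/oner_neq0.
Qed.

Lemma regular_poly Y p : regular_on Y (peval p).
Proof.
move=> x Yx; exists p, (mpolyC _ 1); split; first by rewrite pevalC; apply/eqP/oner_neq0.
by move=> y Yy _; rewrite pevalC divr1.
Qed.

Lemma regular_cst Y (c : C) : regular_on Y (fun=> c).
Proof.
move=> x Yx; have [p [q [qx H]]] := regular_poly (mpolyC _ c) Yx.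
by exists p, q; split=> // y Yy qy; rewrite -H// pevalC.
Qed.

Lemma regular_coord Y i j : regular_on Y (fun x => x i j).
Proof.
move=> x Yx; have [p [q [qx H]]] := regular_poly (mpolyX _ (mnm1 (mxvec_index i j))) Yx.
by exists p, q; split=> // y Yy qy; rewrite -H// /peval mevalXU mxvecE.
Qed.

Lemma eq_regular Y f g : (forall x, Y x -> f x = g x) ->
  regular_on Y f -> regular_on Y g.
Proof.
move=> fg rf x Yx; have [p [q [qx H]]] := rf x Yx.
by exists p, q; split=> // y Yy qy; rewrite -fg// H.
Qed.

Lemma regular_sub Y U f : U `<=` Y -> regular_on Y f -> regular_on U f.
Proof.
move=> sUY rf x /sUY Yx; have [p [q [qx H]]] := rf x Yx.
by exists p, q; split=> // y /sUY; exact: H.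
Qed.

Lemma regularD Y f g : regular_on Y f -> regular_on Y g ->
  regular_on Y (fun x => f x + g x).
Proof.
move=> rf rg x Yx; have [p [q [/eqP qx H]]] := rf x Yx; have [p' [q' [/eqP qx' H']]] := rg x Yx.
exists (p * q' + p' * q), (q * q'); split.
  by rewrite pevalM; apply/eqP; rewrite mulf_neq0.
move=> y Yy; rewrite !pevalM pevalD !pevalM => /eqP; rewrite mulf_eq0 negb_or => /andP[qy qy'].
by rewrite H//; last exact/eqP; rewrite H'//; [rewrite addf_div|apply/eqP].
Qed.

Lemma regularM Y f g : regular_on Y f -> regular_on Y g ->
  regular_on Y (fun x => f x * g x).
Proof.
move=> rf rg x Yx; have [p [q [/eqP qx H]]] := rf x Yx; have [p' [q' [/eqP qx' H']]] := rg x Yx.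
exists (p * p'), (q * q'); split.
  by rewrite pevalM; apply/eqP; rewrite mulf_neq0.
move=> y Yy; rewrite !pevalM => /eqP; rewrite mulf_eq0 negb_or => /andP[qy qy'].
by rewrite H//; last exact/eqP; rewrite H'//; [rewrite mulf_div|apply/eqP].
Qed.

Lemma regularV Y f : (forall x, Y x -> f x <> 0) -> regular_on Y f ->
  regular_on Y (fun x => (f x)^-1).
Proof.
move=> f0 rf x Yx; have [p [q [/eqP qx H]]] := rf x Yx.
have px : peval p x != 0.
  by apply/eqP => p0; apply: (f0 x Yx); rewrite H ?p0 ?mul0r//; exact/eqP.
(* The inverse is [q / p]; the extra factor [q] restricts to points where [f = p / q] is known. *)
exists (q * q), (p * q); split=> [|y Yy]; first by rewrite pevalM; apply/eqP; rewrite mulf_neq0.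
rewrite !pevalM => /eqP; rewrite mulf_eq0 negb_or => /andP[py qy].
by rewrite H//; [rewrite invf_div -mulf_div divff// mulr1|exact/eqP].
Qed.

Lemma regular_sum Y (I : Type) (r : seq I) (P : pred I) (F : I -> 'M[C]_(a, b) -> C) :
  (forall i, P i -> regular_on Y (F i)) ->
  regular_on Y (fun x => \sum_(i <- r | P i) F i x).
Proof.
move=> rF; elim: r => [|i r IH].
  by apply: eq_regular (regular_cst 0) => x _; rewrite big_nil.
have [Pi|nPi] := boolP (P i).
  by apply: eq_regular (regularD (rF i Pi) IH) => x _; rewrite big_cons Pi.
by apply: eq_regular IH => x _; rewrite big_cons (negbTE nPi).
Qed.

Lemma regular_prod Y (I : Type) (r : seq I) (P : pred I) (F : I -> 'M[C]_(a, b) -> C) :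
  (forall i, P i -> regular_on Y (F i)) ->
  regular_on Y (fun x => \prod_(i <- r | P i) F i x).
Proof.
move=> rF; elim: r => [|i r IH].
  by apply: eq_regular (regular_cst 1) => x _; rewrite big_nil.
have [Pi|nPi] := boolP (P i).
  by apply: eq_regular (regularM (rF i Pi) IH) => x _; rewrite big_cons Pi.
by apply: eq_regular IH => x _; rewrite big_cons (negbTE nPi).
Qed.

Lemma regularX Y f k : regular_on Y f -> regular_on Y (fun x => f x ^+ k).
Proof.
move=> rf; elim: k => [|k IH].
  by apply: eq_regular (regular_cst 1) => x _; rewrite expr0.
by apply: eq_regular (regularM rf IH) => x _; rewrite exprS.
Qed.

Lemma zopen_regular_neq0 Y f : regular_on Y f ->
  zopen_in Y [set x | Y x /\ f x <> 0].
Proof.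
move=> rf; apply/zopenP; split=> [x []//|x [Yx fx]].
have [p [q [/eqP qx H]]] := rf x Yx; exists (p * q); split.
  rewrite pevalM; apply/eqP; rewrite mulf_neq0//; apply/eqP => p0; apply: fx.
  by rewrite H ?p0 ?mul0r//; exact/eqP.
move=> y Yy; rewrite pevalM => /eqP; rewrite mulf_eq0 negb_or => /andP[py qy].
by split=> //; rewrite H//; apply/eqP; rewrite // mulf_neq0// invr_neq0.
Qed.

End OneSpace.

Section TwoSpaces.
Variables a b c d : nat.
Variables (Y : set 'M[C]_(a, b)) (Z : set 'M[C]_(c, d)) (F : 'M[C]_(a, b) -> 'M[C]_(c, d)).
Hypothesis rF : forall i j, regular_on Y (fun x => F x i j).

Lemma regular_comp_poly p : regular_on Y (fun x => peval p (F x)).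
Proof.
rewrite /peval; apply: eq_regular => [x _|]; first by rewrite mevalE.
apply: regular_sum => m _; apply: regularM; first exact: regular_cst.
apply: regular_prod => k _; apply: regularX.
by case/mxvec_indexP: k => i j; apply: eq_regular (rF i j) => x _; rewrite mxvecE.
Qed.

Hypothesis FZ : forall x, Y x -> Z (F x).

Lemma regular_comp f : regular_on Z f -> regular_on Y (f \o F).
Proof.
move=> rf x Yx; have [p [q [/eqP qx H]]] := rf _ (FZ Yx).
have [p1 [q1 [/eqP q1x H1]]] := @regular_comp_poly p x Yx.
have [p2 [q2 [/eqP q2x H2]]] := @regular_comp_poly q x Yx.
have p2x : peval p2 x != 0.
  by apply: contra_neq qx => p20; rewrite H2 ?p20 ?mul0r//; exact/eqP.
(* This is [p1 / q1] divided by [p2 / q2], with a spare factor [q2] so that a nonzero denominator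
   makes all the fractions involved valid. *)
exists (p1 * q2 * q2), (q1 * p2 * q2).
split=> [|y Yy]; first by rewrite !pevalM; apply/eqP; rewrite !mulf_neq0.
rewrite !pevalM => /eqP; rewrite !mulf_eq0 !negb_or => /andP[/andP[q1y p2y] q2y].
rewrite /= H; [|exact: FZ|by rewrite H2//; apply/eqP; rewrite // mulf_neq0// invr_neq0].
rewrite H1//; last exact/eqP.
rewrite H2//; last exact/eqP.
by field; rewrite q2y p2y q1y.
Qed.

Lemma zopen_preimage U : zopen_in Z U -> zopen_in Y (Y `&` F @^-1` U).
Proof.
move=> /zopenP[sU hU]; apply/zopenP; split=> [x []//|x [Yx /= Ux]].
have [s [sx hs]] := hU _ Ux.
have [_ /(_ x)[//|t [tx ht]]] := (zopenP _ _).1 (zopen_regular_neq0 (regular_comp_poly s)).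
by exists t; split=> // y Yy ty; split=> //; apply: hs (ht y Yy ty).2; exact: FZ.
Qed.

End TwoSpaces.
End ZariskiTheory.

(** * Irreducibility of connected groups *)

Section MatrixFunctions.
Variable R : realType.
Local Notation C := R[i].
Variables a b : nat.
Implicit Types (Y : set 'M[C]_(a, b)).

Lemma regular_det Y k (F : 'M[C]_(a, b) -> 'M[C]_k) :
  (forall i j, regular_on Y (fun x => F x i j)) ->
  regular_on Y (fun x => \det (F x)).
Proof.
move=> rF; apply: regular_sum => s _; apply: regularM; first exact: regular_cst.
by apply: regular_prod => i _; exact: rF.
Qed.

Lemma regular_mulmx Y k l m (F : 'M[C]_(a, b) -> 'M[C]_(k, l)) (G : 'M[C]_(a, b) -> 'M[C]_(l, m)) :
  (forall i j, regular_on Y (fun x => F x i j)) ->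
  (forall i j, regular_on Y (fun x => G x i j)) ->
  forall i j, regular_on Y (fun x => (F x *m G x) i j).
Proof.
move=> rF rG i j; apply: (@eq_regular _ _ _ _ (fun x => \sum_k F x i k * G x k j)) => [x _|].
  by rewrite mxE.
by apply: regular_sum => r _; exact: regularM.
Qed.

Lemma regular_invmx Y k (F : 'M[C]_(a, b) -> 'M[C]_k) :
  (forall x, Y x -> F x \in unitmx) ->
  (forall i j, regular_on Y (fun x => F x i j)) ->
  forall i j, regular_on Y (fun x => (invmx (F x)) i j).
Proof.
move=> uF rF i j.
apply: (@eq_regular _ _ _ _ (fun x => (\det (F x))^-1 * \adj (F x) i j)) => [x Yx|].
  by rewrite /invmx uF// [RHS]mxE.
apply: regularM.
  apply: regularV; last exact: regular_det.
  by move=> x /uF; rewrite unitmxE unitfE => /eqP.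
apply: (@eq_regular _ _ _ _ (fun x => cofactor (F x) j i)) => [x _|]; first by rewrite [RHS]mxE.
apply: regularM; first exact: regular_cst.
apply: regular_det => r s.
by apply: eq_regular (rF (lift j r) (lift i s)) => x _; rewrite !mxE.
Qed.

End MatrixFunctions.

Section Irreducibility.
Variable R : realType.
Local Notation C := R[i].
Variable n : nat.
Implicit Types (U V : set 'M[C]_n).

(** Membership in the algebraic tensor product of functions of [h] and functions of [u]; the size of
    [I] will bound matrix ranks. *)
Definition separated (F : 'M[C]_n -> 'M[C]_n -> C) :=
  exists (I : finType) (al be : I -> 'M[C]_n -> C),
    forall h u, F h u = \sum_i al i h * be i u.

Lemma eq_separated F F' : (forall h u, F h u = F' h u) -> separated F -> separated F'.
Proof. by move=> e [I [al [be H]]]; exists I, al, be => h u; rewrite -e H. Qed.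

Lemma separated_cst c : separated (fun _ _ => c).
Proof.
exists unit, (fun _ _ => c), (fun _ _ => 1) => h u.
by rewrite (big_pred1 tt) ?mulr1// => -[].
Qed.

Lemma separatedD F F' : separated F -> separated F' ->
  separated (fun h u => F h u + F' h u).
Proof.
move=> [I [al [be H]]] [I' [al' [be' H']]].
exists (I + I')%type, (fun i => match i with inl i => al i | inr i => al' i end),
  (fun i => match i with inl i => be i | inr i => be' i end) => h u.
by rewrite big_sumType /= H H'.
Qed.

Lemma separatedM F F' : separated F -> separated F' ->
  separated (fun h u => F h u * F' h u).
Proof.
move=> [I [al [be H]]] [I' [al' [be' H']]].
exists (I * I')%type, (fun i h => al i.1 h * al' i.2 h), (fun i u => be i.1 u * be' i.2 u) => h u.
rewrite H H' big_distrlr /= pair_bigA /=; apply: eq_bigr => i _; ring.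
Qed.

Lemma separated_sum (I : Type) (r : seq I) (F : I -> 'M[C]_n -> 'M[C]_n -> C) :
  (forall i, separated (F i)) -> separated (fun h u => \sum_(i <- r) F i h u).
Proof.
move=> sF; elim: r => [|i r IH].
  by apply: eq_separated (separated_cst 0) => h u; rewrite big_nil.
by apply: eq_separated (separatedD (sF i) IH) => h u; rewrite big_cons.
Qed.

Lemma separated_prod (I : Type) (r : seq I) (F : I -> 'M[C]_n -> 'M[C]_n -> C) :
  (forall i, separated (F i)) -> separated (fun h u => \prod_(i <- r) F i h u).
Proof.
move=> sF; elim: r => [|i r IH].
  by apply: eq_separated (separated_cst 1) => h u; rewrite big_nil.
by apply: eq_separated (separatedM (sF i) IH) => h u; rewrite big_cons.
Qed.

(** Each entry of [h *m u] is a sum of products of an entry of [h] and an entry of [u]: this is the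
    comultiplication on the coordinate ring of matrices. *)
Lemma separated_poly (p : mpoly (n * n) C) : separated (fun h u => peval p (h *m u)).
Proof.
apply: eq_separated => [h u|]; first by rewrite /peval mevalE.
apply: separated_sum => mu; apply: separatedM; first exact: separated_cst.
apply: separated_prod => k; case/mxvec_indexP: k => i j.
elim: (mu _) => [|e IH].
  by apply: eq_separated (separated_cst 1) => h u; rewrite expr0.
apply: (@eq_separated (fun h u => (\sum_k h i k * u k j) * (mxvec (h *m u) 0 (mxvec_index i j)) ^+ e)).
  by move=> h u; rewrite exprS mxvecE mxE.
apply: separatedM IH; exists 'I_n, (fun k h => h i k), (fun k u => u k j) => h u.
by [].
Qed.

Variable G : set 'M[C]_n.
Hypothesis hG : algebraic_group G.
Variable p : mpoly (n * n) C.

Let Gunit g : G g -> g \in unitmx. Proof. by case: hG => -[H _ _ _] _; exact: H. Qed.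
Let G1 : G 1%:M. Proof. by case: hG => -[]. Qed.
Let GM g h : G g -> G h -> G (g *m h). Proof. by case: hG => -[_ _ H _] _; exact: H. Qed.
Let GV g : G g -> G (invmx g). Proof. by case: hG => -[_ _ _ H] _; exact: H. Qed.

(* The rank of p on U: a Zariski-local complexity which is bounded, invariant
   under left translation, and drops when p vanishes on an open part of U but
   not on U.  It replaces noetherianity in the proof of irreducibility. *)
Definition minor U k := exists h u : 'I_k -> 'M[C]_n,
  [/\ forall i, G (h i), forall i, U (u i)
    & \det (\matrix_(i, j) peval p (h i *m u j)) != 0].

(** The matrix of values [p (h_i u_j)] factors through a space of dimension [#|I|], which depends on
    [p] alone. *)
Lemma minor_bound : exists N, forall U k, minor U k -> (k <= N)%N.
Proof.
have [I [al [be H]]] := separated_poly p; exists #|I| => U k [h [u [_ _ d0]]].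
set M := (M in \det M) in d0.
have ME : M = (\matrix_(i < k, j < #|I|) al (enum_val j) (h i)) *m
              (\matrix_(i < #|I|, j < k) be (enum_val i) (u j)).
  apply/matrixP => i j; rewrite !mxE H (reindex _ (onW_bij _ (enum_val_bij I))).
  by apply: eq_bigr => s _; rewrite !mxE.
have : row_free M by rewrite row_free_unit unitmxE unitfE.
rewrite /row_free => /eqP <-.
by rewrite ME; apply: leq_trans (mxrankM_maxl _ _) (rank_leq_col _).
Qed.

(** Since [h_i u_j = (h_i g^-1) (g u_j)], moving the set by [g] leaves the matrix unchanged. *)
Lemma minor_translate g U k : G g -> minor (G `&` mulmx g @^-1` U) k -> minor U k.
Proof.
move=> Gg [h [u [Gh Uu d0]]]; exists (fun i => h i *m invmx g), (fun j => g *m u j).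
split=> [i|i|]; first by apply: GM => //; exact: GV.
  by case: (Uu i).
suff -> : (\matrix_(i, j) peval p (h i *m invmx g *m (g *m u j))) =
  (\matrix_(i, j) peval p (h i *m u j)) by [].
by apply/matrixP => i j; rewrite !mxE -!mulmxA (mulKmx (Gunit Gg)).
Qed.

(** Adding the row of the identity and the column of [u] gives a block triangular matrix: the new
    row is [p (v_j) = 0] on the old columns and [p u <> 0] in the corner. *)
Lemma minor_extend U V k u : V `<=` U -> (forall v, V v -> peval p v = 0) ->
  U u -> peval p u <> 0 -> minor V k -> minor U (k + 1).
Proof.
move=> sVU p0 Uu /eqP pu [h [v [Gh Vv d0]]].
exists (fun i : 'I_(k + 1) => match fintype.split i with inl i => h i | inr _ => 1%:M end),
  (fun i : 'I_(k + 1) => match fintype.split i with inl i => v i | inr _ => u end).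
split=> [i|i|]; first by case: fintype.split => // j; exact: Gh.
  by case: fintype.split => // j; apply: sVU; exact: Vv.
rewrite (_ : \matrix_(i, j) _ = block_mx (\matrix_(i, j) peval p (h i *m v j))
   (\matrix_(i < k, j < 1) peval p (h i *m u)) 0 (peval p u)%:M).
  by rewrite det_ublock det_scalar expr1 mulf_neq0.
apply/matrixP => i j; rewrite mxE.
case: (split_ordP i) => i' ->; case: (split_ordP j) => j' ->.
- by rewrite block_mxEul mxE.
- by rewrite block_mxEur mxE.
- by rewrite block_mxEdl mxE mul1mx p0.
- by rewrite block_mxEdr mul1mx !ord1 mxE eqxx.
Qed.

Let maxminor U k := minor U k /\ forall j, minor U j -> (j <= k)%N.

Let maxminor_ex U : exists k, maxminor U k.
Proof.
have [N hN] := minor_bound.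
have ex : exists k, `[< minor U k >].
  exists 0%N; apply/asboolP; exists (fun=> 1%:M), (fun=> 1%:M).
  by split=> [[]|[]|]//; rewrite det_mx00 oner_neq0.
have bd k : `[< minor U k >] -> (k <= N)%N by move=> /asboolP /hN.
case: (ex_maxnP ex bd) => k /asboolP mk hk; exists k; split=> // j mj.
by apply: hk; apply/asboolP.
Qed.

Let zopen_translate g U : G g -> zopen_in G U -> zopen_in G (G `&` mulmx g @^-1` U).
Proof.
move=> Gg; apply: zopen_preimage => [|x]; last exact: GM.
by apply: regular_mulmx => i j; [exact: regular_cst|exact: regular_coord].
Qed.

(** By translation the local rank of [p] has the same minimal value near every point, whereas it
    would have to jump at a boundary point of the set where [p] vanishes locally. That set is
    therefore open and closed. *)
Lemma connected_group_identity V : zconnected G -> zopen_in G V -> V !=set0 ->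
  (forall x, V x -> peval p x = 0) -> forall x, G x -> peval p x = 0.
Proof.
move=> [_ Gconn] oV [v0 Vv0] pV.
(* The least rank [r] over open neighbourhoods of the identity is attained on [U0]; each translate
   [Ug g] is a neighbourhood of [g] of rank at most [r]. *)
pose good r := exists U, [/\ zopen_in G U, U 1%:M & maxminor U r].
have [r [U0 [oU0 U01 mU0]] rmin] : exists2 r, good r & forall k, good k -> (r <= k)%N.
  have ex : exists r, `[< good r >].
    have [k mk] := maxminor_ex G; exists k; apply/asboolP; exists G; split=> //.
    exact: zopenT.
  case: (ex_minnP ex) => r /asboolP gr rm; exists r => // k gk.
  by apply: rm; apply/asboolP.
pose Ug g := G `&` mulmx (invmx g) @^-1` U0.
have oUg g : G g -> zopen_in G (Ug g) by move=> Gg; apply: zopen_translate => //; exact: GV.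
have Ugg g : G g -> Ug g g by move=> Gg; split=> //=; rewrite mulVmx// Gunit.
(* Translated to the identity, [W] has rank at least [r]; a point of [Ug g] where [p] is nonzero
   would then push the rank on [U0] above [r]. *)
have flat g W : G g -> zopen_in G W -> W !=set0 -> W `<=` Ug g ->
    (forall x, W x -> peval p x = 0) -> forall x, Ug g x -> peval p x = 0.
  move=> Gg oW [w Ww] WU pW x Ux; apply: contrapT => px.
  have Gw : G w by case: (WU _ Ww).
  have [k [mk hk]] := maxminor_ex (G `&` mulmx w @^-1` W).
  have rk : (r <= k)%N.
    apply: rmin; exists (G `&` mulmx w @^-1` W); split=> //.
      exact: zopen_translate.
    by split=> //=; rewrite mulmx1.
  have := minor_extend WU pW Ux px (minor_translate Gw mk).
  by move=> /(minor_translate (GV Gg)) /mU0.2; rewrite addn1 ltnNge rk.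
pose Z := [set x | exists W, [/\ zopen_in G W, W x & forall y, W y -> peval p y = 0]].
have oZ : zopen_in G Z.
  apply/zopenP; split=> [x [W [/zopenP[sW _] Wx _]]|x [W [oW Wx pW]]]; first exact: sW.
  have [_ /(_ x Wx)[s [sx hs]]] := (zopenP _ _).1 oW.
  by exists s; split=> // y Gy sy; exists W; split=> //; exact: hs.
have oZ' : zopen_in G (G `\` Z).
  apply/zopenP; split=> [x []//|x [Gx nZx]].
  have [_ /(_ x (Ugg _ Gx))[s [sx hs]]] := (zopenP _ _).1 (oUg x Gx).
  exists s; split=> // y Gy sy; split=> // -[W [oW Wy pW]]; apply: nZx.
  exists (Ug x); split=> //; [exact: oUg|exact: Ugg|].
  apply: (flat x (W `&` Ug x)) => //.
  - by apply: zopenI => //; exact: oUg.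
  - by exists y; split=> //; exact: hs.
  - by move=> z [Wz _]; exact: pW.
have [||Z0|Z'0] := Gconn _ _ oZ oZ'.
- by move=> x Gx; have [|] := pselect (Z x); [left|right].
- by apply/seteqP; split=> // x [Zx [_ /(_ Zx)]].
- have Zv0 : Z v0 by exists V.
  by move: Zv0; rewrite Z0.
- move=> x Gx; apply: contrapT => px.
  have : (G `\` Z) x by split=> // -[W [_ /[swap]]] /[apply].
  by rewrite Z'0.
Qed.

End Irreducibility.

(** * Irreducibility of the group and of its quotient *)

Section GroupsAndQuotients.
Variable R : realType.
Local Notation C := R[i].
Variables n m : nat.
Variables (G H : set 'M[C]_n) (X : set 'rV[C]_m) (pi : 'M[C]_n -> 'rV[C]_m).
Hypothesis hG : algebraic_group G.
Hypothesis Gconn : zconnected G.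

(** A polynomial nonzero at a point of [U] but at no point of [G] outside [U] would vanish on a
    disjoint [V], hence on all of [G]. *)
Lemma connected_group_openI U V : zopen_in G U -> zopen_in G V ->
  U !=set0 -> V !=set0 -> U `&` V !=set0.
Proof.
move=> oU oV [u Uu] V0; apply: contrapT => UV.
have [sU /(_ u Uu)[s [su hs]]] := (zopenP _ _).1 oU.
apply: su; apply: (connected_group_identity hG Gconn oV V0) => [x Vx|]; last exact: sU.
apply: contrapT => sx; apply: UV; exists x; split=> //; apply: hs sx.
by have [sV _] := (zopenP _ _).1 oV; exact: sV.
Qed.

Hypothesis hX : quasi_affine_quotient G H X pi.

Lemma quotient_map g : G g -> X (pi g).
Proof. by move=> Gg; rewrite -(qaq_surjective hX); exists g. Qed.

Lemma quotient_lift x : X x -> exists2 g, G g & pi g = x.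
Proof. by rewrite -(qaq_surjective hX). Qed.

Lemma quotient_openI U V : zopen_in X U -> zopen_in X V ->
  U !=set0 -> V !=set0 -> U `&` V !=set0.
Proof.
move=> oU oV [u Uu] [v Vv].
have rpi i j : regular_on G (fun g => pi g i j).
  by rewrite (ord1 i); exact: qaq_morphism hX j.
have [sU _] := (zopenP _ _).1 oU; have [sV _] := (zopenP _ _).1 oV.
have [a Ga au] := quotient_lift (sU _ Uu); have [b Gb bv] := quotient_lift (sV _ Vv).
have [||g [[_ /= Ug] [_ /= Vg]]] := connected_group_openI
  (zopen_preimage rpi quotient_map oU) (zopen_preimage rpi quotient_map oV).
- by exists a; split=> //=; rewrite au.
- by exists b; split=> //=; rewrite bv.
- by exists (pi g).
Qed.

Lemma quotient_identity q U : zopen_in X U -> U !=set0 ->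
  (forall x, U x -> peval q x = 0) -> forall x, X x -> peval q x = 0.
Proof.
move=> oU Un qU x Xx; apply: contrapT => qx.
have oq := zopen_regular_neq0 (@regular_poly _ _ _ X q).
have [|y [Uy [_]]] := quotient_openI oU oq Un; first by exists x.
by apply; exact: qU.
Qed.

End GroupsAndQuotients.

(** * Formal and convergent Laurent series *)

Section FormalLaurent.
Variable R : realType.
Local Notation C := R[i].
Implicit Types (L M P Q : int -> C) (a b : nat -> C).

(** The series [t^d * sum_i a_i t^i]; [d] is only a lower bound for the order, as [a 0] may
    vanish. *)
Definition shifted (d : int) a : int -> C :=
  fun k => if k - d is Posz i then a i else 0.

Lemma shiftedE d a (i : nat) : shifted d a (d + i%:Z) = a i.
Proof. by rewrite /shifted addrC addKr. Qed.

Lemma shifted_lt d a k : k < d -> shifted d a k = 0.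
Proof. by rewrite /shifted -subr_lt0; case: (k - d). Qed.

Lemma shifted_spec d k : k < d \/ exists i : nat, k = d + i%:Z.
Proof.
have [|dk] := ltP k d; [by left|right; exists `|k - d|%N].
by rewrite gez0_abs ?subr_ge0//; ring.
Qed.

Lemma eq_shifted d L a : (forall k, k < d -> L k = 0) ->
  (forall i : nat, L (d + i%:Z) = a i) -> L = shifted d a.
Proof.
move=> L0 La; apply/funext => k; case: (shifted_spec d k) => [kd|[i ->]].
  by rewrite L0// shifted_lt.
by rewrite La shiftedE.
Qed.

Lemma laurent_shifted L : laurent L <-> exists d a, L = shifted d a.
Proof.
split=> [[d L0]|[d [a ->]]]; last by exists d; exact: shifted_lt.
by exists d, (fun i : nat => L (d + i%:Z)); exact: eq_shifted.
Qed.

Definition conv a b : nat -> C := fun k => \sum_(i < k.+1) a i * b (k - i)%N.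

Lemma lmul_shifted d e a b :
  lmul (shifted d a) (shifted e b) = shifted (d + e) (conv a b).
Proof.
apply: eq_shifted => [k kde|k].
  apply: fsbig1 => i _; case: (shifted_spec d i) => [id|[j ->]].
    by rewrite shifted_lt ?mul0r.
  by rewrite [X in _ * X]shifted_lt ?mulr0//; lia.
(* Only the exponents [d, ..., d + k] of the first factor contribute to the coefficient of
   [t^(d + e + k)]. *)
rewrite /lmul (fsbigE [seq d + i%:Z | i <- iota 0 k.+1])//.
- rewrite big_map -[iota 0 _]/(index_iota 0 k.+1) big_mkord /=.
  rewrite /conv; apply: eq_big => [i|i _]; first exact: in_setT.
  rewrite shiftedE; congr (_ * _).
  rewrite -(shiftedE e b); congr (shifted e b _).
  by rewrite -subzn; [ring|rewrite -ltnS].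
- by rewrite map_inj_uniq ?iota_uniq// => i j /addrI [].
- move=> i _; case: (shifted_spec d i) => [id _|[j ->]].
    by rewrite shifted_lt ?mul0r.
  rewrite (mem_map (f := fun i : nat => d + i%:Z)); last by move=> ? ? /addrI [].
  rewrite mem_iota /= -leqNgt => kj.
  by rewrite [X in _ * X]shifted_lt ?mulr0//; lia.
Qed.

Lemma lmul0 L : lmul L (fun=> 0) = fun=> 0.
Proof. by apply/funext => k; apply: fsbig1 => i _; rewrite mulr0. Qed.

Definition has_ord L (k : int) := L k <> 0 /\ forall j, j < k -> L j = 0.

Lemma has_ord_shifted L k : has_ord L k -> L = shifted k (fun i => L (k + i%:Z)).
Proof. by move=> [_ L0]; exact: eq_shifted. Qed.

Lemma lord_has_ord L k : has_ord L k -> lord L = (k%:E)%E.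
Proof.
move=> [Lk L0]; apply: xget_unique => [|_ [j [Lj L0'] <-]]; first by exists k.
congr (_%:E)%E; apply/eqP; rewrite eq_le; apply/andP; split; rewrite leNgt; apply/negP.
  by move/L0'.
by move/L0.
Qed.

Lemma lord0 : lord (fun=> 0 : C) = +oo%E.
Proof. by apply: xgetPN => x [k [+ _]]. Qed.

Lemma has_ord_first d a i : a i <> 0 -> (forall j, (j < i)%N -> a j = 0) ->
  has_ord (shifted d a) (d + i%:Z).
Proof.
move=> ai a0; split=> [|k kdi]; first by rewrite shiftedE.
case: (shifted_spec d k) => [kd|[j kE]]; first exact: shifted_lt.
by rewrite kE shiftedE a0//; lia.
Qed.

Lemma shifted0P d a : shifted d a = (fun=> 0) <-> forall i, a i = 0.
Proof.
split=> [H i|a0]; first by rewrite -(shiftedE d) H.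
by apply/esym/eq_shifted.
Qed.

Lemma first_nonzero a : (exists i, a i <> 0) ->
  exists2 i, a i <> 0 & forall j, (j < i)%N -> a j = 0.
Proof.
move=> [i ai]; have ex : exists i, a i != 0 by exists i; exact/eqP.
case: (ex_minnP ex) => j /eqP aj jmin; exists j => // k kj.
by apply: contraTeq kj => /jmin; rewrite leqNgt.
Qed.

Lemma laurent_has_ord L : laurent L -> L <> (fun=> 0) -> exists k, has_ord L k.
Proof.
move=> /laurent_shifted[d [a ->]] /shifted0P /existsNP /first_nonzero[i ai a0].
by exists (d + i%:Z); exact: has_ord_first.
Qed.

Lemma has_ord_lmul L M k l : has_ord L k -> has_ord M l -> has_ord (lmul L M) (k + l).
Proof.
move=> oL oM; rewrite (has_ord_shifted oL) (has_ord_shifted oM) lmul_shifted.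
have := @has_ord_first (k + l) (conv (fun i : nat => L (k + i%:Z)) (fun i : nat => M (l + i%:Z))) 0.
rewrite addr0; apply=> //.
rewrite /conv big_ord1 subnn !addr0; apply/eqP; rewrite mulf_neq0//; apply/eqP.
  by case: oL.
by case: oM.
Qed.

(** Long division of power series: the first [n] coefficients of [p / b]. A list is carried because
    each coefficient depends on all earlier ones. *)
Fixpoint quotient_prefix (p b : nat -> C) n : seq C :=
  if n is n'.+1 then
    let s := quotient_prefix p b n' in
    rcons s ((p n' - \sum_(i < n') b (n' - i)%N * s`_i) / b 0%N)
  else [::].

Lemma conv_divide p b : b 0%N != 0 -> exists c, conv b c = p.
Proof.
move=> b0; pose s := quotient_prefix p b; pose c i := (s i.+1)`_i.
have szs n : size (s n) = n by elim: n => //= n IH; rewrite size_rcons IH.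
have sc n i : (i < n)%N -> (s n)`_i = c i.
  elim: n => // n IH; rewrite ltnS leq_eqVlt => /predU1P[->//|lin].
  by rewrite /= nth_rcons szs lin IH.
exists c; apply/funext => k.
have -> : conv b c k = \sum_(i < k) b (k - i)%N * c i + b 0%N * c k.
  rewrite /conv (reindex_inj rev_ord_inj) /= big_ord_recr /= subSS subnn subn0.
  by congr (_ + _); apply: eq_bigr => i _ /=; rewrite subSS subKn// ltnW.
have -> : c k = (p k - \sum_(i < k) b (k - i)%N * c i) / b 0%N.
  rewrite {1}/c /= nth_rcons szs ltnn eqxx; congr ((_ - _) / _).
  by apply: eq_bigr => i _; rewrite sc.
by rewrite [b 0%N * _]mulrC divfK// addrC subrK.
Qed.

Lemma laurent_divide Q P : laurent Q -> Q <> (fun=> 0) -> laurent P ->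
  exists2 L, laurent L & lmul Q L = P.
Proof.
move=> lQ Q0 /laurent_shifted[e [p ->]].
have [k oQ] := laurent_has_ord lQ Q0; rewrite (has_ord_shifted oQ).
have [|c cE] := @conv_divide p (fun i => Q (k + i%:Z)).
  by rewrite addr0; apply/eqP; case: oQ.
exists (shifted (e - k) c); first by apply/laurent_shifted; exists (e - k), c.
by rewrite lmul_shifted cE addrC subrK.
Qed.

End FormalLaurent.

(** * Functions with a Laurent expansion and a geometric remainder *)

Section Expansions.
Variable R : realType.
Local Notation C := R[i].
Implicit Types (L M : int -> C) (a b : nat -> C) (F G : C -> C) (z s A : C).

(** The radii are complex numbers, but [0 < s] forces a positive real. One constant [A] controls
    absolute convergence at [s] and the remainders of every length; the case [N = 0] also bounds
    [z^-d F z]. *)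
Definition expands_at (r : C) (d : int) a F := forall s, 0 < s -> s < r ->
  exists A, (forall N, \sum_(i < N) `|a i| * s ^+ i <= A) /\
    forall z, 0 < `|z| -> `|z| <= s -> forall N,
      `|z ^ (- d) * F z - \sum_(i < N) a i * z ^+ i| <= A * (`|z| / s) ^+ N.

(* The geometric error bound makes expansions stable under products by purely
   finite manipulations. *)
Definition expands (r : C) L F := exists d a, L = shifted d a /\ expands_at r d a F.

Lemma expands_laurent r L F : expands r L F -> laurent L.
Proof. by move=> [d [a [-> _]]]; apply/laurent_shifted; exists d, a. Qed.

(** Multiplication by [t^k], used to give two series the same starting exponent. *)
Definition delay k a : nat -> C := fun i => if (i < k)%N then 0 else a (i - k)%N.

Lemma sum_delay k a z N :
  \sum_(i < N) delay k a i * z ^+ i = z ^+ k * \sum_(i < N - k) a i * z ^+ i.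
Proof.
have [Nk|/ltnW/subnKC <-] := leqP N k.
  rewrite (eqP (_ : N - k == 0)%N) ?subn_eq0// big_ord0 mulr0 big1// => i _.
  by rewrite /delay (leq_trans (ltn_ord i) Nk) mul0r.
rewrite addKn big_split_ord /= big1 ?add0r; last first.
  by move=> i _; rewrite /delay ltn_ord mul0r.
rewrite mulr_sumr; apply: eq_bigr => i _.
by rewrite /delay ltnNge leq_addr /= addKn exprD mulrCA.
Qed.

Lemma norm_delay k a i : `|delay k a i| = delay k (fun i => `|a i|) i.
Proof. by rewrite /delay; case: ifP; rewrite ?normr0. Qed.

Lemma shifted_delay k d a : shifted d a = shifted (d - k%:Z) (delay k a).
Proof.
apply: eq_shifted => [j jd|i]; first by apply: shifted_lt; lia.
rewrite /delay; case: ltnP => ik; first by apply: shifted_lt; lia.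
rewrite -(shiftedE d); congr (shifted _ _ _); rewrite -subzn//; ring.
Qed.

Lemma expands_at_delay r k d a F :
  expands_at r d a F -> expands_at r (d - k%:Z) (delay k a) F.
Proof.
move=> H s s0 sr; have [A [HA Hz]] := H s s0 sr; have sk := exprn_ge0 k (ltW s0).
exists (s ^+ k * A); split=> [N|z z0 zs N].
  under eq_bigr do rewrite norm_delay.
  by rewrite sum_delay ler_wpM2l.
have A0 : 0 <= A by have := HA 0%N; rewrite big_ord0.
have zn0 : z != 0 by rewrite -normr_gt0.
set q := `|z| / s; have q0 : 0 <= q by rewrite divr_ge0// ltW.
have q1 : q <= 1 by rewrite ler_pdivrMr// mul1r.
have zE : `|z| = q * s by rewrite /q divfK// gt_eqF.
rewrite sum_delay opprB expfzDr// -exprnP -!mulrA -mulrBr normrM normrX.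
rewrite {1}zE exprMn -mulrA mulrCA ler_wpM2l//.
apply: le_trans (_ : q ^+ k * (A * q ^+ (N - k)) <= _).
  by rewrite ler_wpM2l ?exprn_ge0//; exact: Hz.
(* Truncated subtraction makes [k + (N - k)] the maximum of [k] and [N], and [q <= 1]. *)
rewrite mulrCA ler_wpM2l// -exprD ler_wiXn2l//; lia.
Qed.

Lemma eq_expands r L F G : (forall z, 0 < `|z| -> `|z| < r -> F z = G z) ->
  expands r L F -> expands r L G.
Proof.
move=> FG [d [a [-> H]]]; exists d, a; split=> // s s0 sr.
have [A [HA Hz]] := H s s0 sr; exists A; split=> // z z0 zs N.
by rewrite -FG ?Hz//; exact: le_lt_trans sr.
Qed.

Lemma expands0 r : expands r (fun=> 0) (fun=> 0).
Proof.
exists 0, (fun=> 0); split; first exact/esym/shifted0P.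
move=> s s0 _; exists 0; split=> [N|z z0 zs N].
  by rewrite big1// => i _; rewrite normr0 mul0r.
by rewrite mul0r mulr0 big1 ?subrr ?normr0// => i _; rewrite mul0r.
Qed.

Lemma expands_lone r : expands r (@lone R) (fun=> 1).
Proof.
exists 0, (fun i => (i == 0%N)%:R); split.
  apply: eq_shifted => [k k0|i]; first by rewrite /lone lt_eqF.
  by rewrite add0r.
have sumE N (u : C) : \sum_(i < N.+1) (i == 0%N :> nat)%:R * u ^+ i = 1.
  by rewrite big_ord_recl /= mul1r expr0 big1 ?addr0// => i _; rewrite mul0r.
move=> s s0 _; exists 1; split=> [N|z z0 zs N].
  under eq_bigr do rewrite normr_nat.
  by case: N => [|N]; rewrite ?big_ord0 ?ler01// sumE.
rewrite oppr0 expr0z mul1r mul1r; case: N => [|N].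
  by rewrite big_ord0 subr0 normr1 expr0.
by rewrite sumE subrr normr0 exprn_ge0// divr_ge0// ltW.
Qed.

Lemma expandsD r L M F G : expands r L F -> expands r M G ->
  expands r (fun k => L k + M k) (fun z => F z + G z).
Proof.
move=> [d [a [-> Ha]]] [e [b [-> Hb]]].
wlog: d a e b F G Ha Hb / exists k : nat, e = d - k%:Z => [H|].
  have [ed|de] := leP e d.
    by apply: H => //; exists `|d - e|%N; lia.
  have : expands r (fun k => shifted e b k + shifted d a k) (fun z => G z + F z).
    by apply: H => //; exists `|e - d|%N; lia.
  rewrite (_ : (fun k => _ + _) = (fun k => shifted d a k + shifted e b k)); last first.
    by apply/funext => k; rewrite addrC.
  by apply: eq_expands => z _ _; rewrite addrC.
move=> [k ek]; rewrite (shifted_delay k d a) -ek.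
have {}Ha : expands_at r e (delay k a) F by rewrite ek; exact: expands_at_delay.
move: (delay k a) Ha => {}a Ha; exists e, (fun i => a i + b i); split.
  apply: eq_shifted => [j je|i]; first by rewrite !shifted_lt// addr0.
  by rewrite !shiftedE.
move=> s s0 sr; have [A [HA Hz]] := Ha s s0 sr; have [B [HB Hw]] := Hb s s0 sr.
exists (A + B); split=> [N|z z0 zs N].
  apply: le_trans (lerD (HA N) (HB N)); rewrite -big_split /=.
  apply: ler_sum => i _; rewrite -mulrDl ler_wpM2r ?exprn_ge0 ?(ltW s0)//.
  exact: ler_normD.
under eq_bigr do rewrite mulrDl.
rewrite big_split /= mulrDr opprD addrACA mulrDl.
by apply: le_trans (ler_normD _ _) _; rewrite lerD ?Hz ?Hw.
Qed.

Lemma expandsZ r c L F : expands r L F ->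
  expands r (fun k => c * L k) (fun z => c * F z).
Proof.
move=> [d [a [-> Ha]]]; exists d, (fun i => c * a i); split.
  apply: eq_shifted => [j je|i]; first by rewrite !shifted_lt// mulr0.
  by rewrite !shiftedE.
move=> s s0 sr; have [A [HA Hz]] := Ha s s0 sr.
exists (`|c| * A); split=> [N|z z0 zs N].
  under eq_bigr do rewrite normrM -mulrA.
  by rewrite -mulr_sumr ler_wpM2l.
under eq_bigr do rewrite -mulrA.
by rewrite -mulr_sumr mulrCA -mulrBr normrM -mulrA ler_wpM2l// Hz.
Qed.

Lemma sum_triangle (T : nat -> nat -> C) N :
  \sum_(k < N) \sum_(i < k.+1) T i (k - i)%N = \sum_(i < N) \sum_(j < N - i) T i j.
Proof.
transitivity (\sum_(k < N) \sum_(i < N | (i <= k)%N) T i (k - i)%N).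
  apply: eq_bigr => k _; rewrite (big_ord_widen N (fun i => T i (k - i)%N))//.
rewrite (exchange_big_dep xpredT)//=; apply: eq_bigr => i _.
rewrite -(big_mkord xpredT (T i)) -{1}(add0n i) -[in RHS](add0n i).
rewrite -(big_mkord (fun k => (0 + i <= k)%N) (fun k => T i (k - i)%N)).
rewrite (_ : \sum_(0 <= j < N - (0 + i)) _ = \sum_(0 <= j < N - i) T i (j + i - i)%N); last first.
  by apply: eq_bigr => j _; rewrite addnK.
rewrite -(big_addn 0 N i xpredT (fun k => T i (k - i)%N)) add0n.
by rewrite [RHS](big_nat_widenl _ 0).
Qed.

Lemma sum_conv a b z N :
  \sum_(k < N) conv a b k * z ^+ k = \sum_(i < N) \sum_(j < N - i) a i * b j * z ^+ (i + j).
Proof.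
rewrite -(sum_triangle (fun i j => a i * b j * z ^+ (i + j))); apply: eq_bigr => k _.
by rewrite mulr_suml; apply: eq_bigr => i _; rewrite subnKC// -ltnS.
Qed.

Lemma sum_prod_ge (x y : nat -> C) (s A B : C) N :
  (forall i, 0 <= x i) -> (forall i, 0 <= y i) -> 0 <= s ->
  \sum_(i < N) x i * s ^+ i <= A -> \sum_(i < N) y i * s ^+ i <= B ->
  \sum_(i < N) \sum_(j < N) x i * y j * s ^+ (i + j) <= A * B.
Proof.
move=> x0 y0 s0 HA HB.
have ge0 (u : nat -> C) : (forall i, 0 <= u i) -> 0 <= \sum_(i < N) u i * s ^+ i.
  by move=> u0; apply: sumr_ge0 => i _; rewrite mulr_ge0// exprn_ge0.
apply: le_trans (ler_pM (ge0 _ x0) (ge0 _ y0) HA HB); rewrite big_distrlr /=.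
by apply: ler_sum => i _; apply: ler_sum => j _; rewrite exprD mulrACA.
Qed.

Lemma expandsM r L M F G : expands r L F -> expands r M G ->
  expands r (lmul L M) (fun z => F z * G z).
Proof.
move=> [d [a [-> Ha]]] [e [b [-> Hb]]]; rewrite lmul_shifted.
exists (d + e), (conv a b); split=> // s s0 sr.
have [A [HA Hz]] := Ha s s0 sr; have [B [HB Hw]] := Hb s s0 sr.
have A0 : 0 <= A by have := HA 0%N; rewrite big_ord0.
have B0 : 0 <= B by have := HB 0%N; rewrite big_ord0.
have AB0 : 0 <= A * B by exact: mulr_ge0.
(* One [A * B] for each of three errors: truncating [G], truncating [F], and cutting the product of
   the truncations down to total degree below [N]. *)
exists (A * B + A * B + A * B); split=> [N|z z0 zs N].
  apply: le_trans (_ : \sum_(k < N) conv (fun i => `|a i|) (fun i => `|b i|) k * s ^+ k <= _).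
    apply: ler_sum => k _; rewrite ler_wpM2r ?exprn_ge0 ?(ltW s0)//.
    by apply: le_trans (ler_norm_sum _ _ _) _; apply: ler_sum => i _; rewrite normrM.
  rewrite sum_conv; apply: le_trans (_ : A * B <= _); last by rewrite -addrA lerDl addr_ge0.
  apply: le_trans (@sum_prod_ge (fun i => `|a i|) (fun i => `|b i|) _ _ _ _ _ _ (ltW s0) (HA N) (HB N)) => //.
  apply: ler_sum => i _; rewrite (big_ord_widen N (fun j => `|a i| * `|b j| * s ^+ (i + j)))// ?leq_subr//.
  rewrite [leRHS](bigID (fun j : 'I_N => (j < N - i)%N)) /= lerDl.
  by apply: sumr_ge0 => j _; rewrite !mulr_ge0// exprn_ge0// ltW.
have zn0 : z != 0 by rewrite -normr_gt0.
set q := `|z| / s; have q0 : 0 <= q by rewrite divr_ge0// ltW.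
have q1 : q <= 1 by rewrite ler_pdivrMr// mul1r.
have zE : `|z| = q * s by rewrite /q divfK// gt_eqF.
set f := z ^ (- d) * F z; set g := z ^ (- e) * G z.
rewrite opprD expfzDr// mulrACA -/f -/g.
have Hf := Hz z z0 zs N; have Hg := Hw z z0 zs N; rewrite -/f -/g in Hf Hg.
set S := \sum_(i < N) _ in Hf; set T := \sum_(i < N) _ in Hg; set P := (X in `|_ - X|).
have f0 : `|f| <= A.
  by have := Hz z z0 zs 0%N; rewrite big_ord0 subr0 expr0 mulr1.
have T0 : `|T| <= B.
  apply: le_trans (HB N); apply: le_trans (ler_norm_sum _ _ _) _.
  apply: ler_sum => i _; rewrite normrM normrX ler_wpM2l//.
  by rewrite lerXn2r// ?nnegrE// ltW.
have -> : f * g - P = f * (g - T) + T * (f - S) + (S * T - P) by ring.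
rewrite !mulrDl; apply: le_trans (ler_normD _ _) _; apply: lerD.
  apply: le_trans (ler_normD _ _) _; apply: lerD.
    by rewrite normrM -mulrA ler_pM.
  by rewrite normrM [A * B]mulrC -mulrA ler_pM.
rewrite /P sum_conv /S /T big_distrlr /= -sumrB.
apply: le_trans (ler_norm_sum _ _ _) _.
rewrite mulrC.
apply: le_trans (ler_wpM2l (exprn_ge0 N q0) (@sum_prod_ge (fun i => `|a i|) (fun i => `|b i|) _ _ _ _ _ _ (ltW s0) (HA N) (HB N))) => //.
rewrite mulr_sumr; apply: ler_sum => i _.
rewrite (big_ord_widen N (fun j => a i * b j * z ^+ (i + j)))// ?leq_subr//.
under eq_bigr do rewrite mulrACA -exprD.
rewrite [X in X - _](bigID (fun j : 'I_N => (j < N - i)%N)) /= addrAC subrr add0r.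
rewrite mulr_sumr [leRHS](bigID (fun j : 'I_N => (j < N - i)%N)) /=.
(* What remains has [i + j >= N], where [|z|^(i+j) = q^(i+j) s^(i+j) <= q^N s^(i+j)]. *)
apply: le_trans (_ : \sum_(j < N | ~~ (j < N - i)%N) q ^+ N * (`|a i| * `|b j| * s ^+ (i + j)) <= _).
  apply: le_trans (ler_norm_sum _ _ _) _; apply: ler_sum => j.
  rewrite -leqNgt => Nij.
  rewrite !normrM normrX zE exprMn mulrCA ler_wpM2r ?mulr_ge0 ?exprn_ge0 ?(ltW s0)//.
  by rewrite ler_wiXn2l// -leq_subLR.
rewrite lerDr; apply: sumr_ge0 => j _.
by rewrite !mulr_ge0// exprn_ge0// ltW.
Qed.

Lemma expands_leval r m k (gam : 'M[int -> C]_(m, k)) (x : C -> 'M[C]_(m, k)) p :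
  (forall i j, expands r (gam i j) (fun z => x z i j)) ->
  expands r (leval p gam) (fun z => peval p (x z)).
Proof.
move=> H; rewrite /leval.
apply: (@eq_expands _ _ (fun z => \sum_(mu <- msupp p) mcoeff mu p *
   \prod_(i < m * k) (mxvec (x z) 0 i) ^+ mu i)) => [z _ _|].
  by rewrite /peval mevalE.
elim: (msupp p) => [|mu ms IH].
  rewrite (_ : (fun k => _) = fun=> 0); last by apply/funext => j; rewrite big_nil.
  by apply: eq_expands (expands0 r) => z _ _; rewrite big_nil.
rewrite (_ : (fun k => _) = fun j => mcoeff mu p * (\big[@lmul R/@lone R]_(i < m * k)
   iter (mu i) (lmul (mxvec gam 0 i)) (@lone R)) j + \sum_(mu <- ms) mcoeff mu p *
    (\big[@lmul R/@lone R]_(i < m * k) iter (mu i) (lmul (mxvec gam 0 i)) (@lone R)) j); last first.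
  by apply/funext => j; rewrite big_cons.
apply: eq_expands => [z _ _|]; first by rewrite big_cons.
apply: expandsD IH; apply: expandsZ.
elim: (index_enum _) => [|i s IH].
  by rewrite big_nil; apply: eq_expands (expands_lone r) => z _ _; rewrite big_nil.
rewrite big_cons; apply: eq_expands => [z _ _|]; first by rewrite big_cons.
apply: expandsM IH; elim: (mu i) => [|e IH].
  by apply: eq_expands (expands_lone r) => z _ _; rewrite expr0.
apply: eq_expands => [z _ _|]; first by rewrite exprS.
apply: expandsM IH; case/mxvec_indexP: i => i j; rewrite mxvecE.
by apply: eq_expands (H i j) => z _ _; rewrite mxvecE.
Qed.

End Expansions.

(** * From pointwise convergence to expansions and leading terms *)

Section ConvergentExpansions.
Variable R : realType.
Local Notation C := R[i].
Implicit Types (L M : int -> C) (a b : nat -> C) (F G : C -> C) (z s A : C).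

Lemma real_part_gt0 (x : C) : 0 < x -> exists2 y : R, 0 < y & x = y%:C%C.
Proof.
move=> x0; exists (complex.Re x); first by move: x0; rewrite ltcE => /andP[].
by rewrite RRe_real// gtr0_real.
Qed.

Lemma geometric_le0 (x q A : C) : 0 <= x -> 0 <= q -> q < 1 ->
  (forall N, x <= A * q ^+ N) -> x = 0.
Proof.
move=> x0 q0 q1 H; apply/eqP; rewrite eq_le x0 andbT.
have A0 : 0 <= A by have := H 0%N; rewrite expr0 mulr1; exact: le_trans.
have toR (y : C) : 0 <= y -> exists y', y = y'%:C%C.
  by move=> y0; exists (complex.Re y); rewrite RRe_real// ger0_real.
have [x' xE] := toR x x0; have [q' qE] := toR q q0; have [A' AE] := toR A A0; subst x q A.
move: x' q' A' x0 q0 q1 A0 H => x q A.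
rewrite !ler0c => x0 q0; rewrite -[1]/(1%:C%C) ltcR => q1 A0 H.
have {}H N : x <= A * q ^+ N by have := H N; rewrite -rmorphXn -rmorphM lecR.
rewrite -[0]/(0%:C%C) lecR.
have cA : (fun N => A * q ^+ N) @ \oo --> A * 0.
  by apply: cvgM; [exact: cvg_cst|apply: cvg_expr; rewrite ger0_norm].
rewrite mulr0 in cA.
apply: (ler_cvg_to (cvg_cst x) cA); exact: nearW.
Qed.

Lemma sum_geometric_le (q : C) N : 0 <= q -> q < 1 ->
  \sum_(i < N) q ^+ i <= (1 - q)^-1.
Proof.
move=> q0 q1; rewrite -[leRHS]mul1r ler_pdivlMr ?subr_gt0// mulrC.
have -> : (1 - q) * \sum_(i < N) q ^+ i = 1 - q ^+ N.
  by rewrite -[RHS]opprB subrX1 -mulNr opprB.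
by rewrite gerBl exprn_ge0.
Qed.

Section Convergent.
Variables (r : C) (L : int -> C) (M : nat) (a : nat -> C).
Hypothesis LE : L = shifted (- M%:Z) a.
Hypothesis cL : forall z, 0 < `|z| -> `|z| < r -> lconverges L z.

(** Once [M <= N], the window of exponents from [-N] to [N] contains the whole principal part, and
    the factor [z^M] turns it into an ordinary partial sum. *)
Lemma lpartial_shifted z N : z != 0 -> (M <= N)%N ->
  z ^+ M * lpartial L z N = \sum_(i < (N + M).+1) a i * z ^+ i.
Proof.
move=> z0 MN; rewrite /lpartial.
rewrite -(big_mkord xpredT (fun i => L (i%:Z - N%:Z) * z ^ (i%:Z - N%:Z))).
rewrite (@big_cat_nat _ _ _ (N - M))//=; last by rewrite (leq_trans (leq_subr _ _))// ltnW// ltnS mul2n -addnn leq_addr.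
rewrite big_nat big1 ?add0r => [|i /andP[_ iN]]; last first.
  by rewrite LE shifted_lt ?mul0r//; lia.
rewrite -{1}(add0n (N - M)%N) big_addn big_mkord.
have -> : ((2 * N).+1 - (N - M) = (N + M).+1)%N by lia.
rewrite mulr_sumr; apply: eq_bigr => i _.
have -> : (i + (N - M))%N%:Z - N%:Z = - M%:Z + i%:Z by lia.
rewrite LE shiftedE mulrCA; congr (_ * _).
by rewrite expfzDr// -exprnN -exprnP mulrA mulfV ?expf_neq0// mul1r.
Qed.

Lemma partial_sums_near z (e : C) : 0 < `|z| -> `|z| < r -> 0 < e ->
  exists N0, forall n, (N0 <= n)%N ->
    `|z ^+ M * lsum L z - \sum_(i < n) a i * z ^+ i| < e.
Proof.
move=> z0 zr e0; have zn0 : z != 0 by rewrite -normr_gt0.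
have zM : 0 < `|z ^+ M| by rewrite normrX exprn_gt0.
have /cvgrPdist_lt/(_ (e / `|z ^+ M|)) := cL z0 zr.
move=> /(_ (divr_gt0 e0 zM))[N1 _ HN1].
exists (N1 + M + M).+1 => n Hn.
have [N NE] : exists N, n = (N + M).+1 by exists (n - M.+1)%N; lia.
have N1N : (N1 <= N)%N by lia.
have MN : (M <= N)%N by lia.
rewrite NE -lpartial_shifted// -mulrBr normrM mulrC -ltr_pdivlMr//.
exact: HN1.
Qed.

Lemma convergent_terms_bounded s : 0 < s -> s < r ->
  exists A, forall i, `|a i| * s ^+ i <= A.
Proof.
move=> s0 sr; have sE : `|s| = s by rewrite gtr0_norm.
have [||N0 HN] := @partial_sums_near s 1 _ _ ltr01; rewrite ?sE//.
have t0 i : 0 <= `|a i| * s ^+ i by rewrite mulr_ge0// exprn_ge0// ltW.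
(* From [N0] on, a term is the difference of two remainders, each less than 1, hence the 2; the sum
   covers the first [N0] terms. *)
exists (2 + \sum_(i < N0) `|a i| * s ^+ i) => i.
have [iN|Ni] := ltnP i N0.
  rewrite (bigD1 (Ordinal iN))//= addrCA lerDl addr_ge0//.
  by apply: sumr_ge0 => j _; exact: t0.
apply: (@le_trans _ _ (2 : C)); last by rewrite lerDl; apply: sumr_ge0 => j _; exact: t0.
have -> : `|a i| * s ^+ i = `|(s ^+ M * lsum L s - \sum_(j < i) a j * s ^+ j) -
    (s ^+ M * lsum L s - \sum_(j < i.+1) a j * s ^+ j)|.
  rewrite big_ord_recr /= -{1}sE -normrX -normrM; congr `|_|; ring.
apply: le_trans (ler_normB _ _) _; rewrite -[2]/(1 + 1) lerD// ltW// HN//.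
exact: leqW.
Qed.

Lemma expands_at_convergent : expands_at r (- M%:Z) a (lsum L).
Proof.
(* Abel's argument: terms bounded at a larger radius [s'] decay at [s] like the powers of
   [s / s']. *)
move=> s s0 sr; have [ss' s'r] := midf_lt sr; set s' := (s + r) / 2 in ss' s'r.
have s'0 : 0 < s' by exact: lt_trans ss'.
have [A0 HA0] := convergent_terms_bounded s'0 s'r.
have A00 : 0 <= A0 by apply: le_trans (HA0 0%N); rewrite mulr_ge0// exprn_ge0// ltW.
pose q' := s / s'.
have q'0 : 0 <= q' by rewrite divr_ge0// ltW.
have q'1 : q' < 1 by rewrite ltr_pdivrMr// mul1r.
pose A := A0 * (1 - q')^-1.
have HA N : \sum_(i < N) `|a i| * s ^+ i <= A.
  apply: le_trans (ler_wpM2l A00 (sum_geometric_le N q'0 q'1)).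
  rewrite mulr_sumr; apply: ler_sum => i _.
  have -> : s = s' * q' by rewrite mulrC divfK// gt_eqF.
  by rewrite exprMn mulrA ler_wpM2r// exprn_ge0.
exists A; split=> // z z0 zs N.
set q := `|z| / s; have q0 : 0 <= q by rewrite divr_ge0// ltW.
have q1 : q <= 1 by rewrite ler_pdivrMr// mul1r.
have zE : `|z| = s * q by rewrite mulrC divfK// gt_eqF.
(* Up to an arbitrary [e], the remainder is a finite block of [N0] further terms, so no infinite
   tail is summed. *)
rewrite opprK -exprnP; apply/ler_addgt0Pr => e e0.
have [N0 HN0] := partial_sums_near z0 (le_lt_trans zs sr) e0.
have := HN0 (N + N0)%N (leq_addl _ _); set l := z ^+ M * _ => Hl.
have -> : l - \sum_(i < N) a i * z ^+ i =
   (\sum_(i < N + N0) a i * z ^+ i - \sum_(i < N) a i * z ^+ i) + (l - \sum_(i < N + N0) a i * z ^+ i).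
  by ring.
apply: le_trans (ler_normD _ _) _; apply: lerD; last exact: ltW.
rewrite big_split_ord /= addrAC subrr add0r.
apply: le_trans (ler_norm_sum _ _ _) _.
apply: le_trans (ler_wpM2r (exprn_ge0 N q0) (HA (N + N0)%N)).
rewrite big_split_ord /= mulrDl.
apply: le_trans (_ : (\sum_(i < N0) `|a (N + i)%N| * s ^+ (N + i)) * q ^+ N <= _).
  rewrite mulr_suml; apply: ler_sum => i _.
  rewrite normrM normrX zE exprMn mulrA ler_wpM2l//.
    by rewrite mulr_ge0// exprn_ge0// ltW.
  by rewrite ler_wiXn2l// leq_addr.
rewrite lerDr mulr_ge0 ?exprn_ge0// sumr_ge0// => i _.
by rewrite mulr_ge0// exprn_ge0// ltW.
Qed.

End Convergent.

Lemma expands_convergent (r : C) L : laurent L ->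
  (forall z, 0 < `|z| -> `|z| < r -> lconverges L z) -> expands r L (lsum L).
Proof.
(* Replacing the lower bound [d] by [-|d|] gives the nonpositive starting exponent [- M] treated
   above. *)
move=> [d L0] cL; pose a i := L (- `|d|%N%:Z + i%:Z).
have LE : L = shifted (- `|d|%N%:Z) a.
  by apply: eq_shifted => // k kd; apply: L0; lia.
by exists (- `|d|%N%:Z), a; split=> //; exact: expands_at_convergent.
Qed.

(** The coefficient [c] may be zero, so that for fixed [k] the relation is linear in [F]; a nonzero
    [c] makes [k] the exact exponent. *)
Definition leads (F : C -> C) (k : int) (c : C) :=
  t%:C%C ^ (- k) * F t%:C%C @[t --> (0 : R)^'+] --> c.

(** When all coefficients vanish, the remainder bound reads [A (|z|/s)^N] for every [N], with [s]
    chosen between [|z|] and [r]. *)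
Lemma expands_eq0 r F : expands r (fun=> 0) F ->
  forall z, 0 < `|z| -> `|z| < r -> F z = 0.
Proof.
move=> [d [a [/esym/shifted0P a0 H]]] z z0 zr.
have [zs sr] := midf_lt zr; set s := (`|z| + r) / 2 in zs sr.
have s0 : 0 < s by exact: lt_trans zs.
have [A [_ /(_ z z0 (ltW zs)) HA]] := H s s0 sr.
have zn0 : z != 0 by rewrite -normr_gt0.
have /eqP : `|z ^ (- d) * F z| = 0.
  apply: (@geometric_le0 _ (`|z| / s) A) => //.
  - by rewrite divr_ge0// ltW.
  - by rewrite ltr_pdivrMr// mul1r.
  - move=> N; have := HA N; rewrite big1 ?subr0// => i _.
    by rewrite a0 mul0r.
by rewrite normr_eq0 mulf_eq0 (negbTE (expfz_neq0 _ zn0)) => /eqP.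
Qed.

Lemma expands_leads r L F k : 0 < r -> expands r L F -> has_ord L k -> leads F k (L k).
Proof.
move=> r0 [d [a [LE H]]] [Lk Lj].
have [i kE] : exists i : nat, k = d + i%:Z.
  by case: (shifted_spec d k) => // kd; case: Lk; rewrite LE shifted_lt.
have a0 j : (j < i)%N -> a j = 0 by move=> ji; rewrite -(shiftedE d) -LE Lj//; lia.
have -> : L k = a i by rewrite LE kE shiftedE.
have [s0 sr] : 0 < r / 2 /\ r / 2 < r by rewrite divr_gt0// ltr_pdivrMr// ltr_pMr// ltr1n.
set s := r / 2 in s0 sr; have [A [HA Hz]] := H s s0 sr.
have A0 : 0 <= A by have := HA 0%N; rewrite big_ord0.
apply/cvgrPdist_lt => e e0.
(* Truncation at [i.+1] leaves an error [A (t/s)^(i+1)], at most [t * B] after division by [t^i];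
   the summand 1 keeps [B] positive even if [A = 0]. *)
pose B := A / s ^+ i.+1 + 1.
have B0 : 0 < B by rewrite ltr_wpDl// divr_ge0// exprn_ge0// ltW.
have [s1 s10 sE] := real_part_gt0 s0.
have [d1 d10 dE] := real_part_gt0 (divr_gt0 e0 B0).
near=> t; have t0 : 0 < t by near: t; exact: nbhs_right_gt.
have ts : t <= s1 by near: t; exact: nbhs_right_le.
have td : t < d1 by near: t; exact: nbhs_right_lt.
have tC : 0 < t%:C%C by rewrite -[0]/(0%:C%C) ltcR.
have tn : `|t%:C%C| = t%:C%C by rewrite gtr0_norm.
have tn0 : t%:C%C != 0 by rewrite gt_eqF.
have := Hz t%:C%C; rewrite tn => /(_ tC); rewrite sE lecR ts => /(_ isT i.+1).
rewrite big_ord_recr /= big1 ?add0r => [|j _]; last by rewrite a0// mul0r.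
set X := `|_ - _| => HX.
have -> : `|a i - t%:C%C ^ (- k) * F t%:C%C| = X / t%:C%C ^+ i.
  transitivity `|(t%:C%C ^ (- d) * F t%:C%C - a i * t%:C%C ^+ i) / t%:C%C ^+ i|.
    rewrite distrC; congr `|_|; rewrite mulrBl mulfK ?expf_neq0// mulrAC; congr (_ * _ - _).
    by rewrite kE opprD expfzDr// -exprnN.
  by rewrite normrM normfV normrX tn.
have tX : 0 < t%:C%C ^+ i by rewrite exprn_gt0.
rewrite ltr_pdivrMr//; apply: le_lt_trans HX _.
rewrite -sE expr_div_n exprSr mulrA mulrAC mulrA.
rewrite [_ * t%:C%C]mulrC mulrA ltr_pM2r//.
have : t%:C%C < e / B by rewrite dE ltcR.
rewrite ltr_pdivlMr//; apply: le_lt_trans; rewrite ler_pM2l//.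
by rewrite /B lerDl.
Unshelve. all: by end_near. Qed.

End ConvergentExpansions.

(** * Calculus of leading terms at 0 along the positive reals *)

Section LeadingTerms.
Variable R : realType.
Local Notation C := R[i].
Implicit Types (F G : C -> C).

Lemma leads_unique F k c d : leads F k c -> leads F k d -> c = d.
Proof. move=> Fc Fd; exact: (@cvg_unique _ (@norm_hausdorff _ _) _ _ _ _ Fc Fd). Qed.

Lemma leads_near F G k c : (\forall t \near (0 : R)^'+, F t%:C%C = G t%:C%C) ->
  leads F k c -> leads G k c.
Proof.
by move=> FG; apply: cvg_trans; apply: near_eq_cvg; apply: filterS FG => t /= ->.
Qed.

Lemma cvgM_right (f g : R -> C) (c d : C) :
  f t @[t --> (0 : R)^'+] --> c -> g t @[t --> (0 : R)^'+] --> d ->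
  f t * g t @[t --> (0 : R)^'+] --> c * d.
Proof. exact: (@cvgM R[i] R _ _ f g c d). Qed.

Lemma cvgV_right (f : R -> C) (c : C) : c != 0 ->
  f t @[t --> (0 : R)^'+] --> c -> (f t)^-1 @[t --> (0 : R)^'+] --> c^-1.
Proof. exact: (@cvgV R[i] R _ _ f c). Qed.

Lemma cvg_near_right (f g : R -> C) (c : C) :
  (\forall t \near (0 : R)^'+, f t = g t) ->
  f t @[t --> (0 : R)^'+] --> c -> g t @[t --> (0 : R)^'+] --> c.
Proof.
by move=> fg; apply: cvg_trans; apply: near_eq_cvg; apply: filterS fg => t /= ->.
Qed.

Lemma leads0 k : @leads R (fun=> 0) k 0.
Proof.
rewrite /leads (_ : (fun t : R => _) = fun=> 0); first exact: cvg_cst.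
by apply/funext => t; rewrite mulr0.
Qed.

Lemma leads_lin F G k (c d a : C) : leads F k c -> leads G k d ->
  leads (fun z => a * F z + G z) k (a * c + d).
Proof.
move=> Fc Gd; have H := cvgM_right (cvg_cst a) Fc.
rewrite /leads in Gd *.
have -> : (fun t : R => t%:C%C ^ (- k) * (a * F t%:C%C + G t%:C%C)) =
    fun t : R => a * (t%:C%C ^ (- k) * F t%:C%C) + t%:C%C ^ (- k) * G t%:C%C.
  by apply/funext => t; rewrite mulrDr mulrCA.
have H2 := @cvgD R[i] R[i] R _ _ _ _ _ _ (H _) Gd; exact: H2.
Qed.

Lemma leads_sum k d (a l : 'I_d -> C) (F : 'I_d -> C -> C) :
  (forall i, leads (F i) k (l i)) ->
  leads (fun z => \sum_(i < d) a i * F i z) k (\sum_(i < d) a i * l i).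
Proof.
move=> H; elim: (index_enum _) => [|i s IH].
  by rewrite big_nil; apply: (leads_near _ (leads0 k)); apply: nearW => t; rewrite big_nil.
rewrite big_cons; have := leads_lin (a := a i) (H i) IH; apply: leads_near.
by apply: nearW => t; rewrite big_cons.
Qed.

Lemma leads_neq0 F k c : leads F k c -> c <> 0 ->
  \forall t \near (0 : R)^'+, F t%:C%C <> 0.
Proof.
move=> Fc /eqP c0; have N0 := @cvgr_neq0 R[i] R[i] R _ _ _ c Fc c0.
near=> t => Ft; have : t%:C%C ^ (- k) * F t%:C%C != 0 by near: t; exact: N0.
by rewrite Ft mulr0 eqxx.
Unshelve. all: by end_near. Qed.

Lemma real_complex_neq0 (t : R) : 0 < t -> t%:C%C != 0 :> C.
Proof. by move=> t0; rewrite eq_complex /= eqxx andbT gt_eqF. Qed.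

Lemma leads_div F G H k l c d : leads F k c -> leads G l d -> d <> 0 ->
  (\forall t \near (0 : R)^'+, F t%:C%C = H t%:C%C * G t%:C%C) ->
  leads H (k - l) (c / d).
Proof.
move=> Fc Gd d0 FHG; have /eqP d0' := d0.
apply: cvg_near_right (cvgM_right Fc (cvgV_right d0' Gd)).
near=> t; have t0 : 0 < t by near: t; exact: nbhs_right_gt.
have tC := real_complex_neq0 t0.
have -> : F t%:C%C = H t%:C%C * G t%:C%C by near: t.
have /eqP G0 : G t%:C%C <> 0 by near: t; exact: leads_neq0 Gd d0.
have tl0 := expfz_neq0 (- l) tC.
have -> : t%:C%C ^ (- (k - l)) = t%:C%C ^ (- k) / t%:C%C ^ (- l).
  by rewrite invr_expz opprK opprB addrC expfzDr.
by field; rewrite G0 tl0.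
Unshelve. all: by end_near. Qed.

Lemma cvg_real_complex0 : t%:C%C @[t --> (0 : R)^'+] --> (0 : C).
Proof.
apply/cvgrPdist_lt => e e0; have [e1 e10 ->] := real_part_gt0 e0.
near=> t; have t0 : 0 < t by near: t; exact: nbhs_right_gt.
rewrite sub0r normrN normc_def /= expr0n addr0 sqrtr_sqr gtr0_norm// ltcR.
by near: t; exact: nbhs_right_lt.
Unshelve. all: by end_near. Qed.

Lemma leads_lower F k l c : leads F k c -> l < k -> leads F l 0.
Proof.
move=> Fc lk; have [n kE] : exists n : nat, k = l + n.+1%:Z by exists `|k - l|.-1%N; lia.
have X0 : (fun t : R => (t%:C%C : C) ^+ n.+1) @ (0 : R)^'+ --> (0 : C).
  elim: n {kE} => [|n IH]; first exact: cvg_real_complex0.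
  have := cvgM_right cvg_real_complex0 IH; rewrite mul0r.
  by apply: cvg_near_right; apply: nearW => t; rewrite [RHS]exprS.
have := cvgM_right X0 Fc; rewrite mul0r; apply: cvg_near_right.
near=> t; have t0 : 0 < t by near: t; exact: nbhs_right_gt.
rewrite mulrA; congr (_ * _); rewrite exprnP -expfzDr ?real_complex_neq0//.
by congr (_ ^ _); lia.
Unshelve. all: by end_near. Qed.

(** If the exponents differed, the function would lead at the smaller one with coefficient 0. *)
Lemma leads_exponent F k l c d : leads F k c -> c <> 0 -> leads F l d -> d <> 0 -> k = l.
Proof.
move=> Fc c0 Fd d0; apply/eqP; rewrite eq_le; apply/andP; split; rewrite leNgt; apply/negP => H.
  by apply: d0; exact: leads_unique Fd (leads_lower Fc H).
by apply: c0; exact: leads_unique Fc (leads_lower Fd H).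
Qed.

End LeadingTerms.

(** * Orders along the curve *)

Section CurveValuation.
Variable R : realType.
Local Notation C := R[i].
Variables n m : nat.
Variables (G H : set 'M[C]_n) (X : set 'rV[C]_m) (pi : 'M[C]_n -> 'rV[C]_m).
Hypothesis hG : algebraic_group G.
Hypothesis Gconn : zconnected G.
Hypothesis hX : quasi_affine_quotient G H X pi.
Variable gam : 'rV[int -> C]_m.
Hypothesis hgam : forall j, laurent (gam 0 j).
Variable eps : R.
Hypothesis eps0 : 0 < eps.
Hypothesis hconv : forall z : C, 0 < `|z| -> `|z| < eps%:C%C ->
  (forall j, lconverges (gam 0 j) z) /\ X (curve_at gam z).

Let epsC0 : 0 < eps%:C%C :> C. Proof. by rewrite -[0]/(0%:C%C) ltcR. Qed.

Lemma near_curve : \forall t \near (0 : R)^'+,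
  [/\ 0 < `|t%:C%C : C|, `|t%:C%C : C| < eps%:C%C & X (curve_at gam t%:C%C)].
Proof.
near=> t; have t0 : 0 < t by near: t; exact: nbhs_right_gt.
have te : t < eps by near: t; exact: nbhs_right_lt.
have tE : `|t%:C%C : C| = t%:C%C by rewrite gtr0_norm// -[0]/(0%:C%C) ltcR.
have h0 : 0 < `|t%:C%C : C| by rewrite tE -[0]/(0%:C%C) ltcR.
have h1 : `|t%:C%C : C| < eps%:C%C by rewrite tE ltcR.
by split=> //; exact: (hconv h0 h1).2.
Unshelve. all: by end_near. Qed.

Lemma expands_curve p :
  expands eps%:C%C (leval p gam) (fun z => peval p (curve_at gam z)).
Proof.
apply: expands_leval => i j; rewrite (ord1 i).
apply: eq_expands (expands_convergent (hgam j) _) => [z _ _|z z0 ze].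
  by rewrite mxE.
by have [+ _] := hconv z0 ze; apply.
Qed.

Lemma leval_eq0 p : leval p gam = (fun=> 0) ->
  forall z : C, 0 < `|z| -> `|z| < eps%:C%C -> peval p (curve_at gam z) = 0.
Proof. by move=> p0; apply: expands_eq0; rewrite -p0; exact: expands_curve. Qed.

Lemma leval_leads p k : has_ord (leval p gam) k ->
  leads (fun z => peval p (curve_at gam z)) k (leval p gam k).
Proof. by move=> /(expands_leads epsC0 (expands_curve p)). Qed.

Lemma leval_laurent p : laurent (leval p gam).
Proof. exact: expands_laurent (expands_curve p). Qed.

(* Analyticity enters here: the denominator of h at a single point of the curve
   does not vanish identically along the curve. *)
Lemma regular_near_curve h : regular_on X h -> exists p q,
  [/\ leval q gam <> (fun=> 0),
      [set x | X x /\ peval q x <> 0] !=set0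
    & forall x, X x -> peval q x <> 0 -> h x = peval p x / peval q x].
Proof.
move=> rh; have zE : `|(eps / 2)%:C%C : C| = (eps / 2)%:C%C.
  by rewrite gtr0_norm// -[0]/(0%:C%C) ltcR divr_gt0.
have z0 : 0 < `|(eps / 2)%:C%C : C| by rewrite zE -[0]/(0%:C%C) ltcR divr_gt0.
have ze : `|(eps / 2)%:C%C : C| < eps%:C%C by rewrite zE ltcR ltr_pdivrMr// ltr_pMr// ltr1n.
have [_ Xx] := hconv z0 ze; have [p [q [qx hpq]]] := rh _ Xx.
exists p, q; split=> //; last by exists (curve_at gam (eps / 2)%:C%C).
by move=> q0; apply: qx; exact: leval_eq0.
Qed.

(** The unspecified fraction [p / q] behind [curve_pullback] is compared with the fraction [p0 / q0]
    taken at a point of the curve; the two together transfer the formal order to the actual values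
    of [h]. *)
Lemma vhat_regular h : regular_on X h ->
  (vhat X gam h = +oo%E /\ \forall t \near (0 : R)^'+, h (curve_at gam t%:C%C) = 0) \/
  exists k c, [/\ c <> 0, vhat X gam h = (k%:E)%E
                & leads (fun z => h (curve_at gam z)) k c].
Proof.
move=> rh; have [p0 [q0 [q0n U0n hE]]] := regular_near_curve rh.
have oU0 := zopen_regular_neq0 (@regular_poly _ _ _ X q0).
(* Without a witness the pullback would default to the zero series; formal division of [p0] by [q0]
   supplies one. *)
rewrite /vhat; have : exists L, [set L | laurent L /\ exists p q U,
    [/\ zopen_in X U, U !=set0, forall x, U x -> h x * peval q x = peval p x,
        leval q gam <> (fun=> 0) & lmul (leval q gam) L = leval p gam]] L.
  have [L lL LE] := laurent_divide (leval_laurent q0) q0n (leval_laurent p0).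
  exists L; split=> //; exists p0, q0, [set x | X x /\ peval q0 x <> 0]; split=> //.
  by move=> x [Xx qx]; rewrite hE// divfK//; exact/eqP.
move=> /(xgetPex (fun=> 0)); rewrite -/(curve_pullback X gam h).
move: (curve_pullback X gam h) => L [lL [p [q [U [oU Un hU qn LE]]]]].
(* Cross-multiplied, the identity is polynomial and spreads from a nonempty open set to all of [X],
   in particular to the curve. *)
have pq x : X x -> peval p x * peval q0 x = peval p0 x * peval q x.
  move=> Xx; apply/eqP; rewrite -subr_eq0 -!pevalM -pevalB; apply/eqP.
  apply: (quotient_identity hG Gconn hX (zopenI oU oU0)) Xx => [|y [Uy [Xy qy]]].
    exact: (quotient_openI hG Gconn hX).
  have /eqP qy' := qy.
  by rewrite pevalB !pevalM -hU// (hE y Xy qy); field.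
have [l0 oq0] := laurent_has_ord (leval_laurent q0) q0n.
have [l oq] := laurent_has_ord (leval_laurent q) qn.
have nq0 := leads_neq0 (leval_leads oq0) oq0.1.
have nq := leads_neq0 (leval_leads oq) oq.1.
have hpq : \forall t \near (0 : R)^'+, peval p (curve_at gam t%:C%C) =
    h (curve_at gam t%:C%C) * peval q (curve_at gam t%:C%C).
  near=> t; have [_ _ Xt] : [/\ 0 < `|t%:C%C : C|, `|t%:C%C : C| < eps%:C%C & X (curve_at gam t%:C%C)].
    by near: t; exact: near_curve.
  have qt : peval q0 (curve_at gam t%:C%C) <> 0 by near: t.
  have /eqP qt' := qt; apply: (mulIf qt').
  by rewrite pq// (hE _ Xt qt); field.
have [L0|/(laurent_has_ord lL)[k oL]] := pselect (L = fun=> 0).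
  left; rewrite L0 lord0; split=> //.
  move: LE; rewrite L0 lmul0 => /esym P0.
  near=> t; have [t0 te Xt] : [/\ 0 < `|t%:C%C : C|, `|t%:C%C : C| < eps%:C%C & X (curve_at gam t%:C%C)].
    by near: t; exact: near_curve.
  have /eqP qt : peval q (curve_at gam t%:C%C) <> 0 by near: t.
  apply: (mulIf qt); rewrite mul0r.
  transitivity (peval p (curve_at gam t%:C%C)); last exact: leval_eq0.
  by apply/esym; near: t.
right; have := has_ord_lmul oq oL; rewrite LE => oP.
exists k, (leval p gam (l + k) / leval q gam l); split.
- have /eqP P0 := oP.1; have /eqP Q0 := oq.1.
  by apply/eqP; rewrite mulf_neq0// invr_neq0.
- exact: lord_has_ord.
- by rewrite -[k in leads _ k](addKr l) addrC; apply: leads_div (leval_leads oP) (leval_leads oq) oq.1 hpq.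
Unshelve. all: by end_near. Qed.

End CurveValuation.

(** * The spherical function *)

Section RealLimits.
Variable R : realType.
Local Notation C := R[i].

Lemma cvg_complex_real (f : R -> R) (l : R) :
  (f t)%:C%C @[t --> (0 : R)^'+] --> (l%:C%C : C) -> f t @[t --> (0 : R)^'+] --> l.
Proof.
move=> H; apply/cvgrPdist_lt => e e0.
have eC : 0 < e%:C%C :> C by rewrite -[0]/(0%:C%C) ltcR.
have H1 := (@cvgrPdist_lt R[i] R[i] R _ _ _ _).1 H _ eC.
near=> t; rewrite -ltcR.
have -> : `|l - f t|%:C%C = `|(l%:C%C : C) - (f t)%:C%C|.
  by rewrite -rmorphB normc_def /= expr0n addr0 sqrtr_sqr.
by near: t; exact: H1.
Unshelve. all: by end_near. Qed.

Lemma cvg_inv_ln : (ln t)^-1 @[t --> (0 : R)^'+] --> (0 : R).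
Proof.
apply/cvgrPdist_lt => e e0; near=> t.
have t1 : ln t < - e^-1 by near: t; apply: (cvgrNy_lt (@lnNy R)).
have l0 : ln t < 0 by apply: lt_trans t1 _; rewrite oppr_lt0 invr_gt0.
rewrite sub0r normrN normfV ltr0_norm// invf_plt ?posrE ?oppr_gt0//.
by rewrite ltrNr.
Unshelve. all: by end_near. Qed.

(** Here [ln phi = k ln t + ln (t^-k phi)], where the last term tends to [ln rho] and [1 / ln t]
    tends to 0. *)
Lemma log_base_cvg (phi : R -> R) (k : int) (rho : R) : 0 < rho ->
  t ^ (- k) * phi t @[t --> (0 : R)^'+] --> rho ->
  log_base t (phi t) @[t --> (0 : R)^'+] --> (k%:~R : R).
Proof.
move=> rho0 H.
have Hln : ln (t ^ (- k) * phi t) @[t --> (0 : R)^'+] --> ln rho.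
  by apply: (@cvg_comp _ _ _ (fun t : R => t ^ (- k) * phi t) (@ln R) _ _ _ H); exact: continuous_ln.
have : (k%:~R + ln (t ^ (- k) * phi t) * (ln t)^-1) @[t --> (0 : R)^'+] --> (k%:~R + ln rho * 0 : R).
  by apply: cvgD; [exact: cvg_cst|apply: cvgM => //; exact: cvg_inv_ln].
rewrite mulr0 addr0; apply: cvg_trans; apply: near_eq_cvg; near=> t.
have t0 : 0 < t by near: t; exact: nbhs_right_gt.
have t1 : t < 1 by near: t; exact: nbhs_right_lt.
have r0 : 0 < t ^ (- k) * phi t by near: t; apply: cvgr_gt H _ rho0.
have phi0 : 0 < phi t by rewrite pmulr_rgt0 ?exprz_gt0 in r0.
rewrite /log_base lnM ?posrE ?exprz_gt0//.
have lt0 : ln t != 0 by rewrite lt_eqF// ln_lt0// t0.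
rewrite -powR_intmul ?ltW// ln_powR mulrDl mulfK// addrA mulrNz subrr add0r.
by [].
Unshelve. all: by end_near. Qed.

End RealLimits.

Section RowSpan.
Variable F : fieldType.

(** A finite part of [E] of maximal rank already spans [E]. The columns of [cokermx A] then
    annihilate [E], hence [l] by hypothesis, which puts [l] in the row space of [A]. *)
Lemma sub_finite_rows d (E : set 'rV[F]_d) (l : 'rV[F]_d) :
  (forall c : 'cV[F]_d, (forall v, E v -> v *m c = 0) -> l *m c = 0) ->
  exists k (A : 'M[F]_(k, d)), (forall i, E (row i A)) /\ (l <= A)%MS.
Proof.
move=> H.
pose good r := exists k (A : 'M[F]_(k, d)), (forall i, E (row i A)) /\ \rank A = r.
have ex : exists r, `[< good r >].
  by exists 0%N; apply/asboolP; exists 0%N, 0; split=> [[]//|]; exact: mxrank0.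
have bd r : `[< good r >] -> (r <= d)%N by move=> /asboolP[k [A [_ <-]]]; exact: rank_leq_col.
case: (ex_maxnP ex bd) => r /asboolP[k [A [EA rA]]] rmax; exists k, A; split=> //.
have EsubA v : E v -> (v <= A)%MS.
  move=> Ev; have sA : (A <= col_mx A v)%MS by rewrite -addsmxE addsmxSl.
  have [le_r eq_r] := mxrank_leqif_sup sA.
  have : (col_mx A v <= A)%MS.
    rewrite -eq_r eqn_leq le_r rA; apply: rmax; apply/asboolP.
    exists (k + 1)%N, (col_mx A v); split=> // i; case: (split_ordP i) => j ->.
      by rewrite rowKu.
    by rewrite rowKd (ord1 j) row_id.
  by rewrite col_mx_sub => /andP[].
have c0 j : l *m col j (cokermx A) = 0.
  apply: H => v Ev; have := EsubA v Ev.
  by rewrite submxE colE mulmxA => /eqP ->; rewrite mul0mx.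
rewrite submxE; apply/eqP/matrixP => i j; rewrite (ord1 i).
by move/matrixP: (c0 j) => /(_ 0 0); rewrite colE mulmxA -colE mxE => ->; rewrite !mxE.
Qed.

End RowSpan.

(** * The translation action on functions *)

Section Actions.
Variable R : realType.
Local Notation C := R[i].
Variables n m : nat.
Variables (G H : set 'M[C]_n) (X : set 'rV[C]_m) (pi : 'M[C]_n -> 'rV[C]_m).
Hypothesis hG : algebraic_group G.
Hypothesis hX : quasi_affine_quotient G H X pi.
Implicit Types (g h : 'M[C]_n) (f : 'rV[C]_m -> C).

Let Gunit g : G g -> g \in unitmx. Proof. by case: hG => -[+ _ _ _] _; apply. Qed.
Let G1 : G 1%:M. Proof. by case: hG => -[]. Qed.
Let GM g h : G g -> G h -> G (g *m h). Proof. by case: hG => -[_ _ + _] _; apply. Qed.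
Let GV g : G g -> G (invmx g). Proof. by case: hG => -[_ _ _ +] _; apply. Qed.

Lemma invmx_mul g h : g \in unitmx -> h \in unitmx ->
  invmx (g *m h) = invmx h *m invmx g.
Proof.
move=> ug uh; apply: (can_inj (mulKmx (_ : g *m h \in unitmx))); first by rewrite unitmx_mul ug.
by rewrite mulmxV ?unitmx_mul ?ug// mulmxA mulmxK// mulmxV.
Qed.

(** The representative chosen by [xget] differs from [h] by a right factor in [H], which left
    multiplication by [g] preserves. *)
Lemma act_pi g h : G g -> G h -> act G pi g (pi h) = pi (g *m h).
Proof.
move=> Gg Gh; rewrite /act.
have [Gh' ph'] : [set h' | G h' /\ pi h' = pi h] (xget 1%:M [set h' | G h' /\ pi h' = pi h]).
  by apply: xgetPex; exists h.
set h' := xget _ _ in Gh' ph' *.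
apply/(qaq_fibres hX); [exact: GM|exact: GM|].
rewrite invmx_mul ?Gunit// mulmxA -[_ *m _ *m g]mulmxA mulVmx ?Gunit// mulmx1.
exact/(qaq_fibres hX).
Qed.

Lemma act_closed g x : G g -> X x -> X (act G pi g x).
Proof.
move=> Gg /(quotient_lift hX)[h Gh <-]; rewrite act_pi//.
by apply: (quotient_map hX); exact: GM.
Qed.

(** The inverse matches [translate]: the value of a function at any [y] is the value at [x] of one
    of its translates. *)
Lemma act_transitive x y : X x -> X y -> exists2 g, G g & act G pi (invmx g) x = y.
Proof.
move=> /(quotient_lift hX)[a Ga <-] /(quotient_lift hX)[b Gb <-].
exists (a *m invmx b); first by apply: GM => //; exact: GV.
rewrite act_pi//; last by apply/GV/GM => //; exact: GV.
by rewrite invmx_mul ?unitmx_inv ?Gunit// invmxK -mulmxA mulVmx ?Gunit// mulmx1.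
Qed.

Lemma translateE g f x : X x -> translate G X pi g f x = f (act G pi (invmx g) x).
Proof. by move=> Xx; rewrite /translate mem_set. Qed.

Lemma translate_out g f x : ~ X x -> translate G X pi g f x = 0.
Proof. by move=> nX; rewrite /translate memNset. Qed.

Lemma translate1 f : (forall x, ~ X x -> f x = 0) -> translate G X pi 1%:M f = f.
Proof.
move=> f0; apply/funext => x; have [Xx|nX] := pselect (X x); last by rewrite translate_out// f0.
rewrite translateE//; congr f; have [h Gh <-] := quotient_lift hX Xx.
by rewrite invmx1 act_pi// mul1mx.
Qed.

Lemma translate_mul g h f : G g -> G h ->
  translate G X pi g (translate G X pi h f) = translate G X pi (g *m h) f.
Proof.
move=> Gg Gh; apply/funext => x; have [Xx|nX] := pselect (X x); last by rewrite !translate_out.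
rewrite !translateE//; last by apply: act_closed => //; exact: GV.
congr f; have [a Ga <-] := quotient_lift hX Xx.
have GVg := GV Gg; have GVh := GV Gh.
rewrite !act_pi//; [|exact: GV (GM _ _)|exact: GM].
by rewrite invmx_mul ?Gunit// mulmxA.
Qed.

Lemma translate_lin g (c : C) f f' :
  translate G X pi g (fun x => c * f x + f' x) =
  fun x => c * translate G X pi g f x + translate G X pi g f' x.
Proof.
apply/funext => x; have [Xx|nX] := pselect (X x); first by rewrite !translateE.
by rewrite !translate_out// mulr0 addr0.
Qed.

(** With a lift [a] of [x], the function is [f (pi (g^-1 a))], a composite of regular maps. *)
Lemma regular_translate f x : regular_on X f -> X x ->
  regular_on G (fun g => translate G X pi g f x).
Proof.
move=> rf Xx; have [a Ga ax] := quotient_lift hX Xx.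
have rfpi : regular_on G (f \o pi).
  apply: regular_sub ((qaq_functions hX f (zopenT X)).1 rf) => g Gg; split=> //=.
  exact: (quotient_map hX).
apply: (@eq_regular _ _ _ _ ((f \o pi) \o (fun g => invmx g *m a))) => [g Gg|].
  by rewrite /= translateE// -ax act_pi//; exact: GV.
apply: regular_comp rfpi => [|g Gg]; last by apply: GM => //; exact: GV.
apply: regular_mulmx => i j; last exact: regular_cst.
by apply: regular_invmx => // r s; exact: regular_coord.
Qed.

End Actions.

Section CommonOrder.
Variable R : realType.
Local Notation C := R[i].

Lemma common_order d (F : 'I_d -> C -> C) :
  (forall i, (\forall t \near (0 : R)^'+, F i t%:C%C = 0) \/
     exists k c, c <> 0 /\ leads (F i) k c) ->
  (\forall t \near (0 : R)^'+, forall i, F i t%:C%C = 0) \/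
  exists k l, (forall i, leads (F i) k (l i)) /\ exists i, l i <> 0.
Proof.
(* [None] marks a function vanishing near 0; otherwise the pair holds its exponent and leading
   coefficient. *)
move=> H; pose P i (oc : option int * C) := match oc.1 with
  | None => \forall t \near (0 : R)^'+, F i t%:C%C = 0
  | Some k => oc.2 <> 0 /\ leads (F i) k oc.2 end.
have [oc hoc] : {f & forall i, P i (f i)}.
  apply: choice => i; case: (H i) => [Fi|[k [c Fi]]]; first by exists (None, 0).
  by exists (Some k, c).
have [[i0 oi0]|none] := pselect (exists i, isSome (oc i).1); last first.
  left; apply: filter_forall => i; move: (hoc i); rewrite /P.
  case E : (oc i).1 => [k|//] _; case: none; exists i; by rewrite E.
right; pose k i := odflt 0 (oc i).1.
case: (@Order.TotalTheory.arg_minP _ _ _ i0 (fun i => isSome (oc i).1) k oi0) => i1 oi1 kmin.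
(* At the least exponent only the functions attaining it keep their coefficient; all others lead
   with 0. *)
exists (k i1), (fun i => if (oc i).1 == Some (k i1) then (oc i).2 else 0); split.
  move=> i; move: (hoc i); rewrite /P; case E : (oc i).1 => [ki|].
    move=> [c0 Fi]; case: eqP => [[<-]//|ne]; apply: leads_lower Fi _.
    have := kmin i; rewrite E => /(_ isT); rewrite {2}/k E /= le_eqVlt => /predU1P[ek|//].
    by case: ne; rewrite ek.
  move=> Fi; case: eqP => // _; apply: (leads_near _ (@leads0 R (k i1))).
  by apply: filterS Fi => t ->.
exists i1; move: (hoc i1) oi1; rewrite /P /k; case: (oc i1).1 => // k1 [c0 _] _ /=.
by rewrite eqxx.
Qed.

Lemma cvg_norm_sum d (F : 'I_d -> C -> C) k (l : 'I_d -> C) :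
  (forall i, leads (F i) k (l i)) ->
  \sum_(i < d) `|t%:C%C ^ (- k) * F i t%:C%C| ^+ 2 @[t --> (0 : R)^'+] -->
  (\sum_(i < d) `|l i| ^+ 2 : C).
Proof.
move=> H; elim: (index_enum _) => [|i s IH].
  rewrite big_nil; apply: (@cvg_near_right _ (fun=> 0)); last exact: cvg_cst.
  by apply: nearW => t; rewrite big_nil.
have Hn : `|t%:C%C ^ (- k) * F i t%:C%C| @[t --> (0 : R)^'+] --> (`|l i| : C).
  exact: (@cvg_norm R[i] R[i] R _ _ _ _ (H i)).
have H2 := cvgM_right Hn Hn.
have H3 : (`|t%:C%C ^ (- k) * F i t%:C%C| * `|t%:C%C ^ (- k) * F i t%:C%C| +
    \sum_(i <- s) `|t%:C%C ^ (- k) * F i t%:C%C| ^+ 2) @[t --> (0 : R)^'+] -->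
    (`|l i| * `|l i| + \sum_(i <- s) `|l i| ^+ 2 : C).
  exact: (@cvgD R[i] R[i] R _ _ _ _ _ _ H2 IH).
rewrite big_cons expr2; apply: cvg_near_right H3.
by apply: nearW => t; rewrite big_cons expr2.
Qed.

End CommonOrder.

(** * The limit formula *)

Unset Implicit Arguments.

Theorem theorem4 (R : realType) (n m : nat)
  (G B K H : set 'M[R[i]]_n)
  (hG : algebraic_group G) (hGc : zconnected G) (hGr : reductive G)
  (hB : borel G B) (hK : maximal_compact G K)
  (hH : algebraic_group H) (hHG : H `<=` G)
  (X : set 'rV[R[i]]_m) (pi : 'M[R[i]]_n -> 'rV[R[i]]_m)
  (hX : quasi_affine_quotient G H X pi)
  (hsph : spherical G X pi B)
  (gam : 'rV[int -> R[i]]_m)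
  (hgam : laurent_point X gam) (hconv : convergent_curve X gam)
  (lam : 'M[R[i]]_n -> R[i]) (hlam : Lambda_plus G X pi B lam)
  (V : set ('rV[R[i]]_m -> R[i])) (hV : is_V_lambda G X pi B lam V)
  (phi : 'rV[R[i]]_m -> R) (hphi : spherical_function G X pi K V phi)
  (f : 'rV[R[i]]_m -> R[i]) (hf : highest_weight_vector G X pi B V f) :
  (log_base t (phi (curve_at gam t%:C%C)))%:E @[t --> (0 : R)^'+] -->
    (2%:E * er_map (intr : int -> R) (valuation G X pi gam f))%E.
Proof.
have [lgam _ _] := hgam; have [eps [eps0 hcurve]] := hconv.
have nearX := near_curve eps0 hcurve.
have [_ Vreg [[V0 Vlin Vact] _ Vmin] _] := hV.
have [Vf [chi [fn0 _]]] := hf.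
have [ip [d [e [c [_ _ [Ve _ Vspan] c0 [phiE _]]]]]] := hphi.
have G1 : G 1%:M by case: hG => -[].
have Vr h : V h -> regular_on X h by move=> /Vreg[].
have Vout h x : V h -> ~ X x -> h x = 0 by move=> /Vreg[_]; exact.
pose ev (h : 'rV[R[i]]_m -> R[i]) z := h (curve_at gam z).
have vhatV h : V h -> (vhat X gam h = +oo%E /\ \forall t \near (0 : R)^'+, ev h t%:C%C = 0) \/
    exists k a, [/\ a <> 0, vhat X gam h = (k%:E)%E & leads (ev h) k a].
  by move=> Vh; exact: (vhat_regular hG hGc hX lgam eps0 hcurve (Vr h Vh)).
have [|en0|[k [l [el [i0 li0]]]]] := @common_order R d (fun i => ev (e i)).
- move=> i; case: (vhatV _ (Ve i)) => [[_ ?]|[k [a [? _ ?]]]]; first by left.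
  by right; exists k, a.
(* If all [e_i] vanished at a point of the curve, so would all translates of [f]; by transitivity
   their values there exhaust the values of [f], which would be zero. *)
- have [t [et [_ _ Xt]]] := filter_ex (filterI en0 nearX).
  have [y fy] : exists y, f y <> 0.
    by apply: contrapT => no; apply: fn0; apply/funext => y; apply: contrapT => fy; apply: no; exists y.
  have Xy : X y by apply: contrapT => nX; apply: fy; exact: Vout.
  have [g Gg gE] := act_transitive hG hX Xt Xy.
  have [a aE] := Vspan _ (Vact g f Gg Vf).
  exfalso; apply: fy; rewrite -gE -(translateE G pi g f Xt) aE big1// => i _.
  by rewrite [e i _]et mulr0.
have leadsV h a : h = (fun x => \sum_(i < d) a i * e i x) ->
    leads (ev h) k (\sum_(i < d) a i * l i).
  by move=> ->; exact: leads_sum.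
have [g0 Gg0 g0l] : exists2 g, G g & ~ leads (ev (translate G X pi g f)) k 0.
  apply: contrapT => no.
  (* Functions all of whose translates have coefficient 0 at [t^k] form a submodule. It contains
     [f], so by irreducibility it is [V], against [l i0 <> 0]. *)
  pose W := [set h | V h /\ forall g, G g -> leads (ev (translate G X pi g h)) k 0].
  have Wf : W f.
    by split=> // g Gg; apply: contrapT => nl; apply: no; exists g.
  have sW : submodule G X pi W.
    split.
    - split=> // g Gg; apply: (leads_near _ (@leads0 R k)).
      by apply: nearW => t; rewrite /ev /translate; case: ifP.
    - move=> a h h' [Vh hl] [Vh' hl']; split; first exact: Vlin.
      move=> g Gg; rewrite translate_lin.
      by have := leads_lin (a := a) (hl g Gg) (hl' g Gg); rewrite mulr0 addr0.
    - move=> g h Gg [Vh hl]; split; first exact: Vact.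
      move=> g' Gg'; rewrite (translate_mul hG hX)//; apply: hl.
      by case: hG => -[_ _ + _] _; apply.
  case: (Vmin W sW) => [h []//|W0|WV].
    by move: Wf; rewrite W0.
  have [_ /(_ _ G1)] : W (e i0) by rewrite WV.
  rewrite (translate1 hG hX); last by move=> x; exact: Vout.
  by move=> /(leads_unique (el i0)).
(* A linear relation among the [e_j] on [X] passes to their coefficients [l j] in the limit, so [l]
   lies in the span of finitely many vectors of values at points of [X]. *)
have [r [A [EA lA]]] : exists r (A : 'M[R[i]]_(r, d)),
    (forall i, [set v : 'rV[R[i]]_d | exists2 x, X x & v = \row_j e j x] (row i A)) /\
    (\row_j l j <= A)%MS.
  apply: sub_finite_rows => a va.
  have L0 : leads (ev (fun x => \sum_(i < d) a i 0 * e i x)) k 0.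
    apply: (leads_near _ (@leads0 R k)).
    apply: filterS nearX => t [_ _ Xt]; rewrite /ev.
    have /matrixP/(_ 0 0) := va (\row_j e j (curve_at gam t%:C%C))
      (ex_intro2 _ _ _ Xt erefl).
    rewrite !mxE => va0; rewrite -[LHS]va0.
    by apply: eq_bigr => i _; rewrite mxE mulrC.
  apply/matrixP => i j; rewrite !ord1 [RHS]mxE -[RHS](leads_unique (leadsV _ _ erefl) L0).
  by rewrite mxE; apply: eq_bigr => s _; rewrite mxE mulrC.
have [x Ax] : {x & forall i, X (x i) /\ row i A = \row_j e j (x i)}.
  by apply: (@choice _ _ (fun i x => X x /\ row i A = \row_j e j x)) => i; have [y Xy yE] := EA i; exists y.
have [w wA] := submxP lA.
(* The coefficient of [t^k] in the translate of [f], rewritten through point evaluations to make its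
   dependence on [g] regular. *)
pose psi g := \sum_(i < r) w 0 i * translate G X pi g f (x i).
have psiE g : G g -> leads (ev (translate G X pi g f)) k (psi g).
  move=> Gg; have [a aE] := Vspan _ (Vact g f Gg Vf).
  suff -> : psi g = \sum_(i < d) a i * l i by exact: leadsV.
  rewrite /psi aE.
  transitivity (\sum_(i < d) \sum_(j < r) a i * (w 0 j * e i (x j))).
    rewrite exchange_big; apply: eq_bigr => j _; rewrite mulr_sumr.
    by apply: eq_bigr => i _; rewrite mulrCA.
  apply: eq_bigr => i _; rewrite -mulr_sumr; congr (_ * _).
  have -> : l i = (\row_j l j) 0 i by rewrite mxE.
  rewrite wA mxE; apply: eq_bigr => j _; congr (_ * _).
  by have /matrixP/(_ 0 i) := (Ax j).2; rewrite !mxE.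
have rpsi : regular_on G psi.
  apply: regular_sum => i _; apply: regularM; first exact: regular_cst.
  by apply: (regular_translate hG hX (Vr f Vf)); exact: (Ax i).1.
have opsi := zopen_regular_neq0 rpsi.
have vpsi g : G g /\ psi g <> 0 -> vhat X gam (translate G X pi g f) = (k%:E)%E.
  move=> [Gg pg]; case: (vhatV _ (Vact g f Gg Vf)) => [[_ z]|[k' [a [a0 -> la]]]].
    case: pg; apply: leads_unique (psiE g Gg) _.
    apply: (leads_near _ (@leads0 R k)).
    by apply: filterS z => t ->.
  by rewrite (leads_exponent la a0 (psiE g Gg) pg).
have vE : valuation G X pi gam f = (k%:E)%E.
  apply: xget_unique => [|v [U [oU Un Uv]]].
    exists [set g | G g /\ psi g <> 0]; split=> //.
    by exists g0; split=> // p0; apply: g0l; rewrite -p0; exact: psiE.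
  have [|g [Ug pg]] := connected_group_openI hG hGc oU opsi Un.
    by exists g0; split=> // p0; apply: g0l; rewrite -p0; exact: psiE.
  by rewrite -(Uv g Ug) vpsi.
rewrite vE /= -EFinM.
apply: cvg_EFin; first exact: nearW.
(* The form [k + k] matches the square of [t^-k] absorbed into the norms. *)
have -> : (2 * k%:~R : R) = (k + k)%:~R by rewrite intrD; ring.
pose S : R[i] := \sum_(i < d) `|l i| ^+ 2.
have S0 : 0 < S.
  rewrite /S (bigD1 i0)//= ltr_pwDl ?exprn_gt0 ?normr_gt0//; first exact/eqP.
  by apply: sumr_ge0 => i _; rewrite exprn_ge0.
have [rho rho0 rhoE] := real_part_gt0 S0.
apply: (@log_base_cvg R _ _ (c * rho)); first exact: mulr_gt0.
apply: cvg_complex_real.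
have -> : (c * rho)%:C%C = c%:C%C * S by rewrite rhoE; exact: rmorphM.
have Q : c%:C%C * \sum_(i < d) `|t%:C%C ^ (- k) * ev (e i) t%:C%C| ^+ 2
    @[t --> (0 : R)^'+] --> c%:C%C * S.
  by apply: cvgM_right; [exact: cvg_cst|exact: (@cvg_norm_sum R d (fun i => ev (e i)) k l el)].
apply: cvg_near_right Q; near=> t.
have t0 : 0 < t by near: t; exact: nbhs_right_gt.
have [_ _ Xt] : [/\ 0 < `|t%:C%C : R[i]|, `|t%:C%C : R[i]| < eps%:C%C & X (curve_at gam t%:C%C)] by near: t.
have tC : 0 < t%:C%C :> R[i] by rewrite -[0]/(0%:C%C) ltcR.
have -> : (t ^ (- (k + k)) * phi (curve_at gam t%:C%C))%:C%C =
    t%:C%C ^ (- (k + k)) * (phi (curve_at gam t%:C%C))%:C%C.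
  have <- : (t ^ (- (k + k)))%:C%C = t%:C%C ^ (- (k + k)) :> R[i].
    by apply: rmorphXz; rewrite unitfE gt_eqF.
  exact: rmorphM.
rewrite phiE// mulrCA; congr (_ * _); rewrite mulr_sumr; apply: eq_bigr => i _.
rewrite normrM exprMn; congr (_ * _).
rewrite ger0_norm; last by rewrite exprz_ge0// ltW.
by rewrite opprD expfzDr ?gt_eqF// expr2.
Unshelve. all: by end_near. Qed.
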